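(* Let $n\geq 2$, let $\omega_1,\dots,\omega_n\in\mathbb{R}$ and $A=\mathrm{diag}(i\omega_1,\dots,i\omega_n)$. Let $D_1=\{z\in\mathbb{C}^n:|z_j|<1,\ 1\le j\le n\}$ and let $F:D_1\to\mathbb{C}^n$ be analytic with $F(z)=Az+f(z)$, $f(0)=0$, $Df(0)=0$. Assume $A$ is non-resonant and satisfies the Bruno-$s$ condition for some $s>0$ (or, when $n=2$, the one-dimensional Bruno-$s$ condition). Then for every sufficiently small $0<r_{**}<1$ there exist positive constants $A_{**},B_{**},C_{**}$ such that for every $z_0\in\mathbb{C}^n$ with $0<|z_0|<r_{**}/2$ the solution $z(t;z_0)$ of $\dot z=F(z)$, $z(0;z_0)=z_0$, is well defined and satisfies $|z(t;z_0)|\le C_{**}r_{**}$ for all real $t$ with $$|t|\le T_*=A_{**}^{-1}\exp\Big\{B_{**}\big(r_{**}/|z_0|\big)^{1/s}\Big\}.$$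
   Context: $|z|$ denotes the norm $\max_j|z_j|$ on $\mathbb{C}^n$; for $\alpha\in\mathbb{N}^n$, $|\alpha|=\alpha_1+\dots+\alpha_n$. $A=\mathrm{diag}(i\omega)$ is non-resonant if $\alpha\cdot\omega\neq\omega_j$ for all $\alpha\in\mathbb{N}^n$ with $|\alpha|\ge2$ and all $j\in\{1,\dots,n\}$. For an integer $p\geq 3$ let $\Omega(p)=\min\{|\alpha\cdot\omega-\omega_j|: 1\le j\le n,\ \alpha\in\mathbb{N}^n,\ 2\le|\alpha|<p\}$. Bruno-$s$ condition ($s>0$): there is a strictly increasing sequence of positive integers $(p_k)_{k\ge0}$ with $p_1\geq 3$ such that $$\limsup_{|\alpha|\to+\infty}\Big(2\sum_{m=0}^{\kappa(\alpha)}\frac{\log\Omega(p_{m+1})^{-1}}{p_m}-s\log|\alpha|\Big)<+\infty,$$ where $\kappa(\alpha)$ is defined by $p_{\kappa(\alpha)}\le|\alpha|<p_{\kappa(\alpha)+1}$. One-dimensional Bruno-$s$ condition (case $n=2$): $\omega_2\neq0$, $\omega:=-\omega_1/\omega_2$ is a positive irrational number, and $$\limsup_{N\to+\infty}\Big(\sum_{j=0}^{k(N)}\frac{\log q_{j+1}}{q_j}-s\log N\Big)<+\infty,$$ where $(q_j)_{j\ge0}$ are the denominators of the continued fraction convergents of $\omega$ and $k(N)$ is defined by $q_{k(N)}\le N<q_{k(N)+1}$. *)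

(* Defs.v *)
From mathcomp Require Import all_boot all_order all_algebra.
From mathcomp Require Import all_classical all_reals all_analysis.
From mathcomp Require Import complex.
Set Implicit Arguments. Unset Strict Implicit. Unset Printing Implicit Defensive.
Import Order.TTheory GRing.Theory Num.Theory numFieldNormedType.Exports.
Local Open Scope classical_set_scope.
Local Open Scope ring_scope.

Section Defs.
Variable R : realType.

Definition vec (n : nat) := 'I_n -> R[i].

Definition cabs (z : R[i]) : R := Normc.normc z.

Definition vnorm n (z : vec n) : R := \big[Num.max/0]_(j < n) cabs (z j).

Definition vzero n : vec n := fun _ => 0.
Definition vsub n (z a : vec n) : vec n := fun j => z j - a j.

Definition inD1 n (z : vec n) : Prop := forall j, cabs (z j) < 1.

Definition msize n (a : 'I_n -> nat) : nat := (\sum_(j < n) a j)%N.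
Definition mono n (h : vec n) (a : 'I_n -> nat) : R[i] := \prod_(j < n) h j ^+ a j.

(* homogeneous part of degree k of the power series sum_alpha c alpha h^alpha;
   every alpha with |alpha| = k is enumerated exactly once as b : 'I_n -> 'I_(k+1) *)
Definition hom_term n (c : ('I_n -> nat) -> R[i]) (h : vec n) (k : nat) : R[i] :=
  \sum_(b : {ffun 'I_n -> 'I_k.+1} | (\sum_(j < n) (b j : nat))%N == k)
     c (fun j => b j : nat) * mono h (fun j => b j : nat).
Definition hom_abs n (c : ('I_n -> nat) -> R[i]) (h : vec n) (k : nat) : R :=
  \sum_(b : {ffun 'I_n -> 'I_k.+1} | (\sum_(j < n) (b j : nat))%N == k)
     cabs (c (fun j => b j : nat)) * cabs (mono h (fun j => b j : nat)).

Definition analytic_on n (F : vec n -> vec n) (D : vec n -> Prop) : Prop :=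
  forall a, D a -> exists rho : R, 0 < rho /\
    exists c : 'I_n -> ('I_n -> nat) -> R[i],
      forall z, D z -> vnorm (vsub z a) < rho -> forall j,
        cvg ((fun K => \sum_(k < K) hom_abs (c j) (vsub z a) k) @ \oo) /\
        (fun K => complex.Re (\sum_(k < K) hom_term (c j) (vsub z a) k)) @ \oo --> complex.Re (F z j) /\
        (fun K => complex.Im (\sum_(k < K) hom_term (c j) (vsub z a) k)) @ \oo --> complex.Im (F z j).

(* Df(0) = 0 (Frechet derivative at 0 vanishes, given f(0) = 0) *)
Definition Dzero n (f : vec n -> vec n) : Prop :=
  forall eps : R, 0 < eps -> exists delta : R, 0 < delta /\
    forall h, vnorm h < delta -> vnorm (f h) <= eps * vnorm h.

Definition adot n (a : 'I_n -> nat) (w : 'I_n -> R) : R := \sum_(j < n) (a j)%:R * w j.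

Definition nonresonant n (w : 'I_n -> R) : Prop :=
  forall (a : 'I_n -> nat) (j : 'I_n), (2 <= msize a)%N -> adot a w <> w j.

(* Omega(p) = min { |alpha.omega - omega_j| : j, 2 <= |alpha| < p } (a finite set) *)
Definition Omega n (w : 'I_n -> R) (p : nat) : R :=
  inf [set x : R | exists (a : 'I_n -> nat) (j : 'I_n),
         (2 <= msize a < p)%N /\ x = `|adot a w - w j|].

(* Bruno-s condition; "limsup_{|alpha| -> oo} (...) < +oo" is written as: the expression
   is bounded above for all alpha with |alpha| large enough; kappa(alpha) is the k with
   p_k <= |alpha| < p_{k+1} *)
Definition Bruno n (w : 'I_n -> R) (s : R) : Prop :=
  exists p : nat -> nat,
    (forall m, p m < p m.+1)%N /\ (0 < p 0)%N /\ (3 <= p 1)%N /\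
    exists (M : R) (N0 : nat), forall (a : 'I_n -> nat) (k : nat),
      (N0 <= msize a)%N -> (p k <= msize a < p k.+1)%N ->
      2 * (\sum_(m < k.+1) ln ((Omega w (p m.+1))^-1) / (p m)%:R)
        - s * ln (msize a)%:R <= M.

Fixpoint cfx (x : R) (k : nat) : R :=
  match k with
  | 0 => x
  | k'.+1 => let y := cfx x k' in (y - (Num.floor y)%:~R)^-1
  end.
Definition cfa (x : R) (k : nat) : R := (Num.floor (cfx x k))%:~R.
(* (q_{k-1}, q_k) with q_{-1} = 0, q_0 = 1, q_{k+1} = a_{k+1} q_k + q_{k-1} *)
Fixpoint cfqp (x : R) (k : nat) : R * R :=
  match k with
  | 0 => (0, 1)
  | k'.+1 => let: (qm, q) := cfqp x k' in (q, cfa x k'.+1 * q + qm)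
  end.
Definition cfq (x : R) (k : nat) : R := (cfqp x k).2.

Definition irrational (x : R) : Prop := ~ exists q : rat, x = ratr q.

Definition Bruno1 (w1 w2 s : R) : Prop :=
  w2 <> 0 /\ 0 < - w1 / w2 /\ irrational (- w1 / w2) /\
  exists (M : R) (N0 : nat), forall (N k : nat),
    (N0 <= N)%N -> cfq (- w1 / w2) k <= N%:R < cfq (- w1 / w2) k.+1 ->
    (\sum_(j < k.+1) ln (cfq (- w1 / w2) j.+1) / cfq (- w1 / w2) j)
      - s * ln N%:R <= M.

Definition Bruno1_at n (w : 'I_n -> R) (s : R) : Prop :=
  exists i0 i1 : 'I_n, (i0 : nat) = 0%N /\ (i1 : nat) = 1%N /\ Bruno1 (w i0) (w i1) s.

Definition is_sol n (F : vec n -> vec n) (I : set R) (z : R -> vec n) : Prop :=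
  forall t, I t -> inD1 (z t) /\ forall j,
    is_derive t 1 (fun u => complex.Re (z u j)) (complex.Re (F (z t) j)) /\
    is_derive t 1 (fun u => complex.Im (z u j)) (complex.Im (F (z t) j)).

End Defs.

(* Main.v *)
(** Truncate the formal linearisation z = H(v) at order N. Its monomials are indexed by binary
    trees, one small divisor per inner node; Bruno's counting lemma (Davie's, under the
    one-dimensional condition) bounds the product of the divisors along a tree with k leaves by
    (C N^s)^(k-1), so H is close to the identity on a polydisc of radius R1 of order N^-s, and it
    maps the linear flow to curves with defect R1 2^-N. A solution is compared with such curves
    over short time steps; at each step the linearising coordinate v drifts by O(R1 2^-N), which
    leaves a time of order 2^N before v doubles. Choosing N of order |z0|^(-1/s) gives the claim. *)
Require Import Defs.
From mathcomp Require Import all_boot all_order all_algebra.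
From mathcomp Require Import all_classical all_reals all_analysis.
From mathcomp Require Import complex ring lra zify.
Set Implicit Arguments. Unset Strict Implicit. Unset Printing Implicit Defensive.
Import Order.TTheory GRing.Theory Num.Theory numFieldNormedType.Exports.
Local Open Scope classical_set_scope.
Local Open Scope ring_scope.

(** * Calculus on the line and Picard iteration *)

Section RealCalculus.
Variable R : realType.
Implicit Types (f g u v : R -> R) (a b s t K M : R).

(** A Gronwall comparison over the whole time interval would lose a factor exp(L t). Restarting
    after each step of length about 1/L, in the coordinate v where the linear flow is an isometry,
    makes the errors add up instead of multiplying; this is what leaves a time of order 2^N. Since
    1/s stands in the final exponent, the power of N in the divisor bound must be exactly s. The
    generic count of small divisors has density 2/p, and the factor 2 in the Bruno-s sum matches it.
    The one-dimensional sum has no such factor and needs density 1/q + O(1/q'); the surplus is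
    summable because the sum of ln q / q over the convergents is bounded. Existence for all these
    times comes from cutting the field off to a bounded, globally Lipschitz one: its solution is
    global, and the estimates show that the cut-off is never felt. *)

Lemma is_derive_cont f t d : is_derive t (1 : R) f d -> {for t, continuous f}.
Proof.
by move=> h; apply: differentiable_continuous; apply/derivable1_diffP; apply: ex_derive.
Qed.

Lemma mvt_le f df a b M :
  (forall x, Num.min a b <= x <= Num.max a b ->
     is_derive x (1 : R) f (df x) /\ `|df x| <= M) ->
  `|f b - f a| <= M * `|b - a|.
Proof.
wlog ab : a b / a <= b.
  move=> H h; case: (leP a b) => [|/ltW] ab; first exact: H.
  by rewrite distrC (distrC b); apply: H => // x; rewrite minC maxC; apply: h.
rewrite (min_idPl ab) (max_idPr ab) => h.
have [c||c cab ->] := @MVT_segment _ f df a b ab.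
- by rewrite in_itv/= => /andP[c1 c2]; have [] := h c; rewrite ?(ltW c1) ?(ltW c2).
- apply: continuous_in_subspaceT => x; rewrite inE/= in_itv/= => xab.
  by have [/is_derive_cont] := h _ xab.
rewrite normrM ler_wpM2r//; move: cab; rewrite in_itv/= => /h[]//.
Qed.

Lemma derive_le_compare u v du dv t : 0 <= t ->
  (forall s, 0 <= s <= t -> [/\ is_derive s (1 : R) u (du s),
     is_derive s (1 : R) v (dv s) & `|du s| <= dv s]) ->
  `|u t - u 0| <= v t - v 0.
Proof.
move=> t0 h.
have mono (w dw : R -> R) : (forall s, 0 <= s <= t -> is_derive s (1 : R) w (dw s) /\ 0 <= dw s) ->
    w 0 <= w t.
  move=> hw; have [c||c ct E] := @MVT_segment _ w dw 0 t t0.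
  - by rewrite in_itv/= => /andP[c1 c2]; have [] := hw c; rewrite ?(ltW c1) ?(ltW c2).
  - apply: continuous_in_subspaceT => x; rewrite inE/= in_itv/= => xab.
    by have [/is_derive_cont] := hw _ xab.
  rewrite -subr_ge0 E subr0 mulr_ge0//.
  by move: ct; rewrite in_itv/= => /hw[].
have A : (v - u) 0 <= (v - u) t.
  apply: (mono _ (fun s => dv s - du s)) => s /h[d1 d2]; rewrite ler_norml => /andP[h1 h2].
  by split; [exact: is_deriveB|rewrite subr_ge0].
have B : (v + u) 0 <= (v + u) t.
  apply: (mono _ (fun s => dv s + du s)) => s /h[d1 d2]; rewrite ler_norml => /andP[h1 h2].
  by split; [exact: is_deriveD|rewrite addrC -(opprK (dv s)) subr_ge0].
move: A B; rewrite /= ?fctE ler_norml.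
by move=> A B; apply/andP; split; lra.
Qed.

Lemma lipschitz_continuous1 g K : (forall t s, `|g t - g s| <= K * `|t - s|) -> continuous g.
Proof.
move=> h t; apply/cvgrPdist_lt => e e0.
have K0 : 0 < `|K| + 1 by rewrite ltr_wpDl.
near=> s.
apply: (le_lt_trans (h t s)).
apply: (@le_lt_trans _ _ ((`|K| + 1) * `|t - s|)).
  by rewrite ler_wpM2r// (le_trans (ler_norm _))// lerDl.
rewrite -ltr_pdivlMl// mulrC.
near: s; apply: cvgr_dist_lt; first exact: cvg_id.
by rewrite divr_gt0.
Unshelve. all: by end_near. Qed.

Lemma antiderivative_on g T : 0 < T -> continuous g ->
  exists I : R -> R, I 0 = 0 /\ forall t, `|t| < T -> is_derive t (1 : R) I (g t).
Proof.
move=> T0 cg.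
pose mu := @lebesgue_measure R.
pose F x := \int[mu]_(t in [set` `[- T, x]]) (g t).
exists (fun x => F x - F 0); split; first by rewrite subrr.
move=> t; rewrite ltr_norml => /andP[tT1 tT2].
have int : mu.-integrable `[- T, T] (EFin \o g).
  apply: continuous_compact_integrable; first exact: segment_compact.
  exact: continuous_subspaceT.
have [||dF EF] := @continuous_FTC1_closed R g (- T) t T tT2 int.
- exact: tT1.
- exact: cg.
have D : is_derive t (1:R) F (g t).
  by split => //; rewrite -derive1E EF.
have -> : (fun x => F x - F 0) = F - cst (F 0) by [].
have -> : g t = g t - 0 by rewrite subr0.
exact: is_deriveB.
Qed.

Lemma antiderivative g : continuous g ->
  exists I : R -> R, I 0 = 0 /\ forall t, is_derive t (1 : R) I (g t).
Proof.
move=> cg.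
have /choice[J HJ] (T : R) : exists I : R -> R, 0 < T -> I 0 = 0 /\ forall t, `|t| < T -> is_derive t (1 : R) I (g t).
  case: (ltP 0 T) => [T0|T0]; last by exists (fun=> 0).
  by have [I HI] := antiderivative_on T0 cg; exists I.
have JE (T T' t : R) : `|t| < T -> T <= T' -> J T t = J T' t.
  move=> tT TT'.
  have T0 : 0 < T by apply: le_lt_trans tT.
  have [H0 H1] := HJ _ T0; have [H0' H1'] := HJ _ (lt_le_trans T0 TT').
  have := @mvt_le (J T - J T') (fun x => g x - g x) 0 t 0.
  rewrite mul0r normr_le0 !fctE H0 H0' subrr subr0 subr_eq0 => h; apply/eqP/h => x xt.
  have xT : `|x| < T.
    apply: le_lt_trans tT; move: xt; rewrite ge_min le_max => /andP[].
    by move=> /orP[] h1 /orP[] h2; rewrite ler_norml; move: (ler_norm t) (ler_norm (-t)); rewrite normrN; move=> ? ?; apply/andP; split; lra.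
  split; last by rewrite subrr normr0.
  apply: is_deriveB; first exact: H1.
  exact/H1'/(lt_le_trans xT).
(* No single interval serves all t, so the interval grows with t. Two antiderivatives vanishing at 0
   agree on their common interval ([JE]), hence this function coincides near t with one fixed
   antiderivative. *)
exists (fun t => J (`|t| + 1) t); split.
  by have [] := HJ (`|0 : R| + 1); rewrite ?normr0 ?add0r.
move=> t; have T0 : 0 < `|t| + 2 by rewrite ltr_wpDl.
have [_ /(_ t) H] := HJ _ T0.
have {}H : is_derive t 1 (J (`|t| + 2)) (g t) by apply: H; rewrite ltrDl.
apply: (near_eq_is_derive (f := J (`|t| + 2))) => //.
near=> s.
rewrite -(JE (`|s| + 1) (`|t| + 2)) ?ltrDl//.
have : `|s - t| < 1 by near: s; apply: cvgr_distC_lt => //; exact: cvg_id.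
have := ler_distD t s 0; rewrite !subr0 => *; lra.
Unshelve. all: by end_near. Qed.

End RealCalculus.

(** * Modulus, sup norm, and limits with a geometric rate *)

Section ComplexNorm.
Variable R : realType.
Implicit Types (x y : R[i]) (c : R).

Lemma cabs_def x : cabs x = Num.sqrt (complex.Re x ^+ 2 + complex.Im x ^+ 2).
Proof. by case: x. Qed.

Lemma cabs_ge0 x : 0 <= cabs x. Proof. by rewrite cabs_def sqrtr_ge0. Qed.
Lemma cabs0 : cabs (0 : R[i]) = 0. Proof. exact: Normc.normc0. Qed.
Lemma cabs1 : cabs (1 : R[i]) = 1. Proof. exact: Normc.normc1. Qed.
Lemma cabsM x y : cabs (x * y) = cabs x * cabs y. Proof. exact: Normc.normcM. Qed.
Lemma cabsV x : cabs x^-1 = (cabs x)^-1. Proof. exact: Normc.normcV. Qed.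
Lemma cabsD x y : cabs (x + y) <= cabs x + cabs y. Proof. exact: le_normcD. Qed.
Lemma cabsN x : cabs (- x) = cabs x. Proof. exact: normcN. Qed.
Lemma cabsB x y : cabs (x - y) <= cabs x + cabs y.
Proof. by rewrite (le_trans (cabsD _ _))// cabsN. Qed.
Lemma cabsC x y : cabs (x - y) = cabs (y - x).
Proof. by rewrite -cabsN opprB. Qed.

Lemma ReD x y : complex.Re (x + y) = complex.Re x + complex.Re y.
Proof. by case: x; case: y. Qed.
Lemma ImD x y : complex.Im (x + y) = complex.Im x + complex.Im y.
Proof. by case: x; case: y. Qed.
Lemma ReN x : complex.Re (- x) = - complex.Re x. Proof. by case: x. Qed.
Lemma ImN x : complex.Im (- x) = - complex.Im x. Proof. by case: x. Qed.
Lemma ReB x y : complex.Re (x - y) = complex.Re x - complex.Re y.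
Proof. by rewrite ReD ReN. Qed.
Lemma ImB x y : complex.Im (x - y) = complex.Im x - complex.Im y.
Proof. by rewrite ImD ImN. Qed.

Lemma Re_le_cabs x : `|complex.Re x| <= cabs x.
Proof. by rewrite cabs_def -sqrtr_sqr ler_wsqrtr// lerDl sqr_ge0. Qed.
Lemma Im_le_cabs x : `|complex.Im x| <= cabs x.
Proof. by rewrite cabs_def -sqrtr_sqr ler_wsqrtr// lerDr sqr_ge0. Qed.

Lemma cabs_le_ReIm x : cabs x <= `|complex.Re x| + `|complex.Im x|.
Proof.
rewrite cabs_def -(ger0_norm (addr_ge0 (normr_ge0 (complex.Re x)) (normr_ge0 (complex.Im x)))).
rewrite -sqrtr_sqr ler_wsqrtr// sqrrD !real_normK ?num_real//.
by rewrite addrAC lerDl mulrn_wge0// mulr_ge0.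
Qed.

Lemma cabs_le2 x c : `|complex.Re x| <= c -> `|complex.Im x| <= c -> cabs x <= 2 * c.
Proof. by move=> h1 h2; apply: (le_trans (cabs_le_ReIm x)); lra. Qed.

Lemma cabs_real c : cabs (c%:C)%C = `|c|.
Proof. by rewrite cabs_def /= expr0n/= addr0 sqrtr_sqr. Qed.

Lemma cabs_imag c : cabs (0 +i* c)%C = `|c|.
Proof. by rewrite cabs_def /= expr0n/= add0r sqrtr_sqr. Qed.

Lemma cabs_eq0 x : (cabs x == 0) = (x == 0).
Proof.
apply/eqP/eqP => [|->]; last exact: cabs0.
exact: Normc.eq0_normc.
Qed.

Lemma cabs_sum (I : Type) (s : seq I) (P : pred I) (F : I -> R[i]) :
  cabs (\sum_(i <- s | P i) F i) <= \sum_(i <- s | P i) cabs (F i).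
Proof.
elim/big_ind2 : _ => [|a b c d h1 h2|//]; first by rewrite cabs0.
by rewrite (le_trans (cabsD _ _))// lerD.
Qed.

Lemma cabs_prod (I : Type) (s : seq I) (P : pred I) (F : I -> R[i]) :
  cabs (\prod_(i <- s | P i) F i) = \prod_(i <- s | P i) cabs (F i).
Proof. by rewrite (big_morph _ cabsM cabs1). Qed.

Lemma Re_sum (I : Type) (s : seq I) (P : pred I) (F : I -> R[i]) :
  complex.Re (\sum_(i <- s | P i) F i) = \sum_(i <- s | P i) complex.Re (F i).
Proof. exact: (big_morph _ ReD). Qed.

Lemma Im_sum (I : Type) (s : seq I) (P : pred I) (F : I -> R[i]) :
  complex.Im (\sum_(i <- s | P i) F i) = \sum_(i <- s | P i) complex.Im (F i).
Proof. exact: (big_morph _ ImD). Qed.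

Section Vector.
Variable n : nat.
Implicit Types z : vec R n.

Lemma vnorm_ge0 z : 0 <= vnorm z.
Proof. by rewrite /vnorm; elim/big_ind: _ => [//|a b h1 h2|i _]; rewrite ?le_max ?h1 ?cabs_ge0. Qed.

Lemma cabs_le_vnorm z j : cabs (z j) <= vnorm z.
Proof. exact: (le_bigmax _ (fun j => cabs (z j)) j). Qed.

Lemma vnorm_le z c : 0 <= c -> (forall j, cabs (z j) <= c) -> vnorm z <= c.
Proof. by move=> c0 h; apply: bigmax_le. Qed.

Lemma vnorm_triangle z z' : vnorm z <= vnorm z' + vnorm (vsub z z').
Proof.
apply: vnorm_le => [|j]; first by rewrite addr_ge0 ?vnorm_ge0.
have -> : z j = z' j + vsub z z' j by rewrite /vsub addrC subrK.
by rewrite (le_trans (cabsD _ _))// lerD ?cabs_le_vnorm.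
Qed.

End Vector.

(** The limit is the supremum of the increasing lower barriers [u k - 2 * c / 2 ^+ k], which stay
    below the decreasing upper ones; this yields the error bound at every index at once. *)
Lemma geometric_limit (u : nat -> R) c :
  (forall k, `|u k.+1 - u k| <= c / 2 ^+ k) ->
  exists l, forall k, `|l - u k| <= 2 * c / 2 ^+ k.
Proof.
move=> h.
have half k : 2 * c / 2 ^+ k.+1 = c / 2 ^+ k :> R.
  by rewrite exprS invfM; field; rewrite expf_neq0.
have half' k : 2 * c / 2 ^+ k = 2 * (c / 2 ^+ k) :> R by rewrite mulrA.
have c0 k : 0 <= c / 2 ^+ k by apply: le_trans (h k).
pose a k := u k - 2 * c / 2 ^+ k; pose b k := u k + 2 * c / 2 ^+ k.
have ha i d : a i <= a (d + i)%N.
  elim: d => // d /le_trans; apply.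
  rewrite addSn /a half half'; move: (h (d + i)%N); rewrite ler_norml => /andP[h1 h2].
  by have := c0 (d + i)%N; lra.
have hb i d : b (d + i)%N <= b i.
  elim: d => // d; apply: le_trans.
  rewrite addSn /b half half'; move: (h (d + i)%N); rewrite ler_norml => /andP[h1 h2].
  by have := c0 (d + i)%N; lra.
have ab k : a k <= b k by rewrite /a /b half'; have := c0 k; lra.
have hab i j : a i <= b j.
  by apply: (le_trans (ha i j)); apply: (le_trans (ab _)); rewrite addnC hb.
have hs : has_sup (range a).
  by split; [exists (a 0%N), 0%N | exists (b 0%N) => _ [k _ <-]].
exists (sup (range a)) => k; rewrite ler_norml.
have h1 : a k <= sup (range a) by apply: sup_upper_bound => //; exists k.
have h2 : sup (range a) <= b k.
  by apply: ge_sup; [exact: (proj1 hs) | move=> _ [i _ <-]].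
by move: h1 h2; rewrite /a /b => h1 h2; apply/andP; split; lra.
Qed.

Lemma geometric_climit (u : nat -> R[i]) c :
  (forall k, cabs (u k.+1 - u k) <= c / 2 ^+ k) ->
  exists l, forall k, cabs (l - u k) <= 4 * c / 2 ^+ k.
Proof.
move=> h.
have [|a ha] := @geometric_limit (fun k => complex.Re (u k)) c.
  by move=> k; rewrite -ReB; apply: le_trans (h k); exact: Re_le_cabs.
have [|b hb] := @geometric_limit (fun k => complex.Im (u k)) c.
  by move=> k; rewrite -ImB; apply: le_trans (h k); exact: Im_le_cabs.
exists (a +i* b)%C => k.
have -> : 4 * c / 2 ^+ k = 2 * (2 * c / 2 ^+ k) :> R by rewrite !mulrA; congr (_ * _ / _); ring.
by apply: cabs_le2; rewrite ?ReB ?ImB/=.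
Qed.

(** Stands in for passing to the limit: estimates are first proved up to a geometric error. *)
Lemma le_geometric_le (a b c : R) : (forall k : nat, a <= b + c / 2 ^+ k) -> a <= b.
Proof.
move=> h; rewrite leNgt; apply/negP => ba.
pose k := (Num.truncn (c / (a - b))).+1.
have hk : c / (a - b) < 2 ^+ k.
  apply: (lt_le_trans (truncnS_gt _)).
  by rewrite -natrX ler_nat ltnW// ltn_expl.
have := h k; rewrite ltr_pdivrMr ?subr_gt0// mulrC -ltr_pdivrMr ?exprn_gt0// in hk.
lra.
Qed.

End ComplexNorm.

(** * Global solutions of bounded Lipschitz fields *)

Section Picard.
Variables (R : realType) (n : nat).
Implicit Types (u v : R -> vec R n) (a b : R -> vec R n).

Definition deriv_curve u t (a : vec R n) : Prop := forall j,
  is_derive t (1 : R) (fun s => complex.Re (u s j)) (complex.Re (a j)) /\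
  is_derive t (1 : R) (fun s => complex.Im (u s j)) (complex.Im (a j)).

Lemma is_derive_opp (f : R -> R) t d : is_derive (- t) (1 : R) f d ->
  is_derive t (1 : R) (fun s => f (- s)) (- d).
Proof.
move=> h; have := @is_derive1_comp R f -%R t d (- 1) h (is_deriveNid _ _).
by rewrite mulrN1.
Qed.

Lemma deriv_curve_opp u t (a : vec R n) : deriv_curve u (- t) a ->
  deriv_curve (fun s => u (- s)) t (fun j => - a j).
Proof.
move=> h j; have [h1 h2] := h j; rewrite ReN ImN.
by split; [exact: is_derive_opp h1|exact: is_derive_opp h2].
Qed.

Lemma deriv_curve_sub u v t (a b : vec R n) : deriv_curve u t a -> deriv_curve v t b ->
  deriv_curve (fun s => vsub (u s) (v s)) t (vsub a b).
Proof.
move=> hu hv j; have [u1 u2] := hu j; have [v1 v2] := hv j; rewrite ReB ImB; split.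
- have -> : (fun s => complex.Re (vsub (u s) (v s) j)) =
    (fun s => complex.Re (u s j)) - (fun s => complex.Re (v s j)).
    by apply/funext => s; rewrite /vsub ReB.
  exact: is_deriveB.
- have -> : (fun s => complex.Im (vsub (u s) (v s) j)) =
    (fun s => complex.Im (u s j)) - (fun s => complex.Im (v s j)).
    by apply/funext => s; rewrite /vsub ImB.
  exact: is_deriveB.
Qed.

Lemma curve_mvt u a s t M :
  (forall x, Num.min s t <= x <= Num.max s t -> deriv_curve u x (a x) /\ forall j, cabs (a x j) <= M) ->
  forall j, cabs (u t j - u s j) <= 2 * (M * `|t - s|).
Proof.
move=> h j; apply: cabs_le2; rewrite ?ReB ?ImB.
- apply: (@mvt_le _ (fun s => complex.Re (u s j)) (fun s => complex.Re (a s j))) => x /h[/(_ j)[h1 _] h3].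
  by split => //; apply: le_trans (h3 j); exact: Re_le_cabs.
- apply: (@mvt_le _ (fun s => complex.Im (u s j)) (fun s => complex.Im (a s j))) => x /h[/(_ j)[_ h1] h3].
  by split => //; apply: le_trans (h3 j); exact: Im_le_cabs.
Qed.

(* The exponential weight makes the Picard operator a contraction on the whole line. *)
Lemma curve_exp_bound u a Lam kap : 0 < Lam ->
  (forall t, deriv_curve u t (a t)) ->
  (forall t j, cabs (a t j) <= kap * expR (Lam * `|t|)) ->
  forall t j, cabs (u t j - u 0 j) <= 2 * kap / Lam * expR (Lam * `|t|).
Proof.
move=> L0.
have pos u' a' : (forall t, deriv_curve u' t (a' t)) ->
  (forall t j, cabs (a' t j) <= kap * expR (Lam * `|t|)) ->
  forall t j, 0 <= t -> cabs (u' t j - u' 0 j) <= 2 * kap / Lam * expR (Lam * `|t|).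
  move=> hd hb t j t0.
  have k0 : 0 <= kap.
    by have := hb 0 j; rewrite normr0 mulr0 expR0 mulr1; apply: le_trans; exact: cabs_ge0.
  pose v := fun s : R => kap / Lam * expR (Lam * s).
  have dv s : is_derive s (1 : R) v (kap * expR (Lam * s)).
    have h1 : is_derive s (1 : R) ( *%R Lam) Lam.
      by have := @is_deriveZ R R R id Lam s 1 1 (is_derive_id _ _); rewrite /GRing.scale/= mulr1.
    have h2 := @is_derive1_comp R expR ( *%R Lam) s _ _ (is_derive_expR _) h1.
    have := @is_deriveZ R R R _ (kap / Lam) s 1 _ h2.
    rewrite /GRing.scale/= (_ : kap / Lam * _ = kap * expR (Lam * s))//.
    by field; rewrite gt_eqF.
  have key (w dw : R -> R) : (forall s, is_derive s (1 : R) w (dw s)) ->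
      (forall s, `|dw s| <= kap * expR (Lam * `|s|)) -> `|w t - w 0| <= kap / Lam * expR (Lam * `|t|).
    move=> hw hdw.
    have := @derive_le_compare R w v dw (fun s => kap * expR (Lam * s)) t t0.
    rewrite (ger0_norm t0) => /(_ _)/le_trans; apply => [s /andP[s0 _]|].
      by split => //; move: (hdw s); rewrite (ger0_norm s0).
    by rewrite /v gerBl mulr_ge0// ?expR_ge0// divr_ge0// ltW.
  have -> : 2 * kap / Lam * expR (Lam * `|t|) = 2 * (kap / Lam * expR (Lam * `|t|)) by rewrite !mulrA.
  apply: cabs_le2; rewrite ?ReB ?ImB.
  - apply: (key (fun s => complex.Re (u' s j)) (fun s => complex.Re (a' s j))) => s; first by have [] := hd s j.
    by apply: le_trans (hb s j); exact: Re_le_cabs.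
  - apply: (key (fun s => complex.Im (u' s j)) (fun s => complex.Im (a' s j))) => s; first by have [] := hd s j.
    by apply: le_trans (hb s j); exact: Im_le_cabs.
move=> hd hb t j; case: (leP 0 t) => [|t0]; first exact: pos.
have := pos (fun s => u (- s)) (fun s j => - a (- s) j) _ _ (- t) j.
rewrite opprK oppr0 normrN; apply.
- by move=> s; apply: deriv_curve_opp.
- by move=> s i; rewrite cabsN -(normrN s).
- by rewrite oppr_ge0 ltW.
Qed.

(** The bound [M] makes every iterate Lipschitz in time ([lip]), so [G] along it is continuous and
    has an antiderivative; on the curves in [lip] the integral operator is defined. *)
Lemma picard (G : vec R n -> vec R n) (L M : R) (z0 : vec R n) : 0 <= L -> 0 <= M ->
  (forall z z' j, cabs (G z j - G z' j) <= L * vnorm (vsub z z')) ->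
  (forall z j, cabs (G z j) <= M) ->
  exists z : R -> vec R n, z 0 = z0 /\ forall t, deriv_curve z t (G (z t)).
Proof.
move=> L0 M0 GL GM.
pose lip u := forall t s j, cabs (u t j - u s j) <= 2 * (M * `|t - s|).
have lipG u j : lip u -> (forall t s, `|complex.Re (G (u t) j) - complex.Re (G (u s) j)| <= L * (2 * M) * `|t - s|) /\
   (forall t s, `|complex.Im (G (u t) j) - complex.Im (G (u s) j)| <= L * (2 * M) * `|t - s|).
  move=> hu.
  have h t s : cabs (G (u t) j - G (u s) j) <= L * (2 * M) * `|t - s|.
    apply: (le_trans (GL _ _ _)); rewrite -mulrA ler_wpM2l//; apply: vnorm_le => [|i].
      by rewrite !mulr_ge0.
    by rewrite -mulrA; exact: hu.
  by split => t s; rewrite -?ReB -?ImB; apply: le_trans (h t s); rewrite ?Re_le_cabs ?Im_le_cabs.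
have ex u : exists v : R -> vec R n, lip u -> v 0 = z0 /\ forall t, deriv_curve v t (G (u t)).
  case: (pselect (lip u)) => [hu|]; last by exists (fun=> z0).
  have /choice[I HI] j : exists I : R -> R, I 0 = 0 /\ forall t, is_derive t (1 : R) I (complex.Re (G (u t) j)).
    by apply: antiderivative; apply: lipschitz_continuous1; case: (lipG _ j hu).
  have /choice[J HJ] j : exists I : R -> R, I 0 = 0 /\ forall t, is_derive t (1 : R) I (complex.Im (G (u t) j)).
    by apply: antiderivative; apply: lipschitz_continuous1; case: (lipG _ j hu).
  exists (fun t j => z0 j + (I j t +i* J j t)%C) => _; split.
    by apply/funext => j; rewrite (proj1 (HI j)) (proj1 (HJ j)) addr0.
  move=> t j; split.
  - have -> : (fun s => complex.Re (z0 j + (I j s +i* J j s)%C)) = cst (complex.Re (z0 j)) + I j.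
      by apply/funext => s; rewrite ReD.
    rewrite -[X in is_derive _ _ _ X]add0r.
    by apply: is_deriveD; exact: (proj2 (HI j)).
  - have -> : (fun s => complex.Im (z0 j + (I j s +i* J j s)%C)) = cst (complex.Im (z0 j)) + J j.
      by apply/funext => s; rewrite ImD.
    rewrite -[X in is_derive _ _ _ X]add0r.
    by apply: is_deriveD; exact: (proj2 (HJ j)).
have [S HS] := choice ex.
have lipS u : lip u -> lip (S u).
  move=> /HS[_ h] t s j; apply: (curve_mvt (a := fun t => G (u t))) => x _.
  by split; [exact: h|move=> i; exact: GM].
pose u_ k := iter k S (fun=> z0).
have lipu k : lip (u_ k).
  elim: k => [t s j|k /lipS //].
  by rewrite subrr cabs0; do 2!apply: mulr_ge0 => //.
have u0 k : u_ k 0 = z0 by case: k => // k; have [] := HS _ (lipu k).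
have du k t : deriv_curve (u_ k.+1) t (G (u_ k t)) by have [_] := HS _ (lipu k).
(* In the norm weighted by exp(- Lam |t|) one Picard step contracts by [2 * L / Lam <= 1 / 2]; the 1
   keeps [Lam] positive when [L = 0]. *)
pose Lam := 4 * L + 1.
have Lam0 : 0 < Lam by rewrite /Lam; lra.
pose c := 2 * M / Lam.
have c0 : 0 <= c by apply: divr_ge0; [exact: mulr_ge0|exact: ltW].
pose e (t : R) : R := expR (Lam * `|t|).
have e0 (t : R) : 0 <= e t by exact: expR_ge0.
have e1 (t : R) : 1 <= e t by rewrite -expR0 ler_expR mulr_ge0// ltW.
have contr : forall (u v u' v' : R -> vec R n) kap, 0 <= kap -> u' 0 = v' 0 ->
    (forall t, deriv_curve u' t (G (u t))) -> (forall t, deriv_curve v' t (G (v t))) ->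
    (forall t j, cabs (u t j - v t j) <= kap * e t) ->
    forall t j, cabs (u' t j - v' t j) <= kap / 2 * e t.
  move=> u v u' v' kap k0 uv0 hu hv huv t j.
  have := @curve_exp_bound (fun t => vsub (u' t) (v' t)) (fun t => vsub (G (u t)) (G (v t))) Lam (L * kap) Lam0.
  rewrite /vsub uv0 => /(_ _ _ t j); rewrite subrr subr0 => /(_ _ _)/le_trans; apply.
  - by move=> s; apply: deriv_curve_sub.
  - move=> s i; apply: (le_trans (GL _ _ _)); rewrite -mulrA ler_wpM2l//.
    by apply: vnorm_le => [|i2]; [exact: mulr_ge0|exact: huv].
  rewrite ler_wpM2r// ler_pdivrMr// /Lam.
  by have := mulr_ge0 L0 k0; lra.
have step k : forall t j, cabs (u_ k.+1 t j - u_ k t j) <= c / 2 ^+ k * e t.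
  elim: k => [|k IH] t j.
    rewrite expr0 divr1 /=.
    have := @curve_exp_bound (u_ 1%N) (fun t => G (u_ 0%N t)) Lam M Lam0 (du 0%N) _ t j.
    rewrite (u0 1%N)=> h; apply: h => s i; apply: (le_trans (GM _ _)); by apply: ler_peMr => //; exact: e1.
  rewrite exprS invfM mulrA (mulrC c) -(mulrA _ c) -(mulrC (c / _)).
  apply: (contr (u_ k.+1) (u_ k)) => //; first by rewrite divr_ge0// exprn_ge0.
  by rewrite !u0.
have /choice[z Hz] : forall tj : R * 'I_n, exists l, forall k, cabs (l - u_ k tj.1 tj.2) <= 4 * (c * e tj.1) / 2 ^+ k.
  by move=> [t j]; apply: geometric_climit => k; rewrite mulrAC; exact: step.
pose zz t : vec R n := fun j => z (t, j).
have hz k t j : cabs (zz t j - u_ k t j) <= 4 * c / 2 ^+ k * e t.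
  by have := Hz (t, j) k; rewrite /= mulrA mulrAC.
have lipz : lip zz.
  move=> t s j; apply: (@le_geometric_le _ _ _ (4 * c * e t + 4 * c * e s)) => k.
  have -> : zz t j - zz s j = (zz t j - u_ k t j) + (u_ k t j - u_ k s j) - (zz s j - u_ k s j) by ring.
  apply: (le_trans (cabsB _ _)); apply: (le_trans (lerD (cabsD _ _) (lexx _))).
  have -> : (4 * c * e t + 4 * c * e s) / 2 ^+ k = 4 * c / 2 ^+ k * e t + 4 * c / 2 ^+ k * e s.
    by rewrite mulrDl (mulrAC _ (e t)) (mulrAC _ (e s)).
  have := hz k t j; have := hz k s j; have := lipu k t s j; lra.
have [S0 dS] := HS _ lipz.
have Sz : S zz = zz.
  apply/funext => t; apply/funext => j; apply/eqP; rewrite -subr_eq0 -cabs_eq0 eq_le cabs_ge0 andbT.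
  apply: (@le_geometric_le _ _ _ (4 * c * e t)) => k; rewrite add0r.
  have h1 := hz k.+1 t j.
  have k0 : 0 <= 4 * c / 2 ^+ k by apply: divr_ge0; [exact: mulr_ge0|exact: exprn_ge0].
  have h2 := @contr zz (u_ k) (S zz) (u_ k.+1) _ k0 (etrans S0 (esym (u0 _))) dS (du k) (hz k) t j.
  have -> : S zz t j - zz t j = (S zz t j - u_ k.+1 t j) - (zz t j - u_ k.+1 t j) by ring.
  apply: (le_trans (cabsB _ _)); rewrite mulrAC.
  have E : 4 * c / 2 ^+ k.+1 = 4 * c / 2 ^+ k / 2 by rewrite exprSr invfM mulrA.
  by rewrite E in h1; move: h1 h2; rewrite (mulrAC _ (2^-1)); lra.
exists zz; split; first by rewrite -Sz S0.
by move=> t; rewrite -{1}Sz; exact: dS.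
Qed.

End Picard.

(** * Polynomials indexed by words and by trees *)

Section WordPolynomials.
Variables (R : realType) (n : nat).
Local Notation word := (seq 'I_n).
Implicit Types (p : seq (R[i] * word)) (z : vec R n) (X : R) (s : word).

Definition wev p z : R[i] := \sum_(c <- p) c.1 * \prod_(i <- c.2) z i.
Definition wnorm X p : R := \sum_(c <- p) cabs c.1 * X ^+ size c.2.

Lemma word_bound z X s : vnorm z <= X -> cabs (\prod_(i <- s) z i) <= X ^+ size s.
Proof.
move=> zX; rewrite cabs_prod; elim: s => [|i s IH]; first by rewrite big_nil expr0.
rewrite big_cons exprS ler_pM ?cabs_ge0 ?prodr_ge0// => [j _|]; first exact: cabs_ge0.
exact: le_trans (cabs_le_vnorm _ _) zX.
Qed.

Lemma wev_bound0 p z X : vnorm z <= X -> cabs (wev p z) <= wnorm X p.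
Proof.
move=> zX; apply: (le_trans (cabs_sum _ _ _)); apply: ler_sum => c _.
by rewrite cabsM ler_wpM2l ?cabs_ge0// word_bound.
Qed.

Lemma wnorm_scale p X th k : 0 <= X -> 0 <= th <= 1 ->
  (forall c, c \in p -> (k <= size c.2)%N) -> wnorm (th * X) p <= th ^+ k * wnorm X p.
Proof.
move=> X0 /andP[t0 t1] hk; rewrite /wnorm big_distrr/=.
rewrite big_seq [leRHS]big_seq; apply: ler_sum => c cp.
rewrite exprMn mulrCA ler_wpM2r//; first by rewrite mulr_ge0 ?cabs_ge0 ?exprn_ge0.
by rewrite ler_wiXn2l// hk.
Qed.

Lemma wev_bound p z X th k : 0 <= X -> 0 <= th <= 1 -> vnorm z <= th * X ->
  (forall c, c \in p -> (k <= size c.2)%N) -> cabs (wev p z) <= th ^+ k * wnorm X p.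
Proof.
move=> X0 t01 zX hk; apply: (le_trans (wev_bound0 p zX)); exact: wnorm_scale.
Qed.

(** A monomial of degree k has Lipschitz constant k (X/2)^(k-1) on the polydisc of radius X/2, and k
    <= 2^(k-1) leaves X^(k-1): halving the radius absorbs the degree. *)
Lemma word_lipschitz z z' X s : vnorm z <= X / 2 -> vnorm z' <= X / 2 ->
  cabs (\prod_(i <- s) z i - \prod_(i <- s) z' i) * X <= X ^+ size s * vnorm (vsub z z').
Proof.
move=> hz hz'; have X0 : 0 <= X by have := vnorm_ge0 z; lra.
set d := vnorm _; have d0 : 0 <= d by exact: vnorm_ge0.
elim: s => [|i s IH].
  by rewrite !big_nil subrr cabs0 mul0r expr0 mul1r.
have hi : cabs (z i - z' i) <= d by exact: (cabs_le_vnorm (vsub z z')).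
case: s IH => [|i' s] IH.
  by rewrite !big_seq1/= expr1 mulrC ler_wpM2l.
move: IH; set s1 := i' :: s; rewrite 2![in X in _ -> X]big_cons.
set P := \prod_(j <- s1) z j; set P' := \prod_(j <- s1) z' j => IH.
have -> : z i * P - z' i * P' = z i * (P - P') + (z i - z' i) * P' by ring.
have hP' : cabs P' <= X ^+ size s1 / 2.
  apply: (le_trans (word_bound s1 hz')); rewrite expr_div_n ler_wpM2l ?exprn_ge0//.
  by rewrite lef_pV2 ?posrE ?exprn_gt0// exprS ler_peMr// exprn_ege1// ler1n.
apply: (@le_trans _ _ ((X / 2 * cabs (P - P') + d * (X ^+ size s1 / 2)) * X)).
  rewrite ler_wpM2r//; apply: (le_trans (cabsD _ _)); rewrite !cabsM lerD//.
    by rewrite ler_wpM2r ?cabs_ge0// (le_trans (cabs_le_vnorm _ _)).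
  by rewrite ler_pM ?cabs_ge0.
rewrite [size (_ :: _)]/= exprS mulrDl -mulrA.
have h1 := @ler_wpM2l _ (X / 2) (divr_ge0 X0 (ler0n _ _)) _ _ IH.
apply: (le_trans (lerD h1 (lexx _))).
rewrite (_ : X / 2 * _ + _ = X * X ^+ size s1 * d)//.
by field.
Qed.

Lemma wev_lipschitz p z z' X : 0 < X -> vnorm z <= X / 2 -> vnorm z' <= X / 2 ->
  cabs (wev p z - wev p z') <= wnorm X p / X * vnorm (vsub z z').
Proof.
move=> X0 hz hz'; rewrite /wev -sumrB mulrAC ler_pdivlMr// mulr_suml.
rewrite (eq_bigr (fun c => c.1 * (\prod_(i <- c.2) z i - \prod_(i <- c.2) z' i))); last first.
  by move=> c _; rewrite mulrBr.
apply: (le_trans (ler_wpM2r (ltW X0) (cabs_sum _ _ _))).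
rewrite mulr_suml; apply: ler_sum => c _.
rewrite cabsM -!mulrA ler_wpM2l ?cabs_ge0//; exact: word_lipschitz.
Qed.

Lemma wev_cat p q z : wev (p ++ q) z = wev p z + wev q z.
Proof. by rewrite /wev big_cat. Qed.

End WordPolynomials.

(** * The formal linearisation with uncollected terms *)

Section TreePolynomials.
Variables (R : realType) (n : nat).
Local Notation word := (seq 'I_n).

(* Terms are kept uncollected, indexed by the binary tree of products that created them, so that
   the small divisors a term has met can be read off its index. *)
Inductive tree : Type := Leaf of 'I_n | Node of tree & tree.

Fixpoint leaves t : word :=
  match t with Leaf i => [:: i] | Node a b => leaves a ++ leaves b end.

Definition tsize t := size (leaves t).

Lemma tsize_Node a b : tsize (Node a b) = (tsize a + tsize b)%N.
Proof. by rewrite /tsize /= size_cat. Qed.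

Lemma tsize_gt0 t : (0 < tsize t)%N.
Proof. by elim: t => // a Ha b Hb; rewrite tsize_Node ltn_addr. Qed.

Definition freq (w : 'I_n -> R) (s : word) : R := \sum_(i <- s) w i.

Local Notation tpoly := (seq (R[i] * tree)).
Implicit Types (p q : tpoly) (H : 'I_n -> tpoly) (W : tree -> R) (f : seq (R[i] * word)).

Definition flat p : seq (R[i] * word) := [seq (c.1, leaves c.2) | c <- p].
Definition tnorm W p : R := \sum_(c <- p) cabs c.1 * W c.2.
Definition pmul p q : tpoly := [seq (a.1 * b.1, Node a.2 b.2) | a <- p, b <- q].

(** A one-letter word creates no node, so each [Node] stems from a genuine product. The empty word
    is sent to the zero polynomial, a junk value that the evaluation lemmas exclude. *)
Fixpoint pw H (s : word) : tpoly :=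
  if s is i :: s' then (if s' is [::] then H i else pmul (H i) (pw H s')) else [::].

Definition tscale (c : R[i]) p : tpoly := [seq (c * a.1, a.2) | a <- p].
Definition psubst f H : tpoly := flatten [seq tscale c.1 (pw H c.2) | c <- f].
Definition ptrunc N p : tpoly := [seq a <- p | (1 < tsize a.2 <= N)%N].
(** Inverse of the homological operator p -> Dp.Av - i w_j p, which is diagonal on monomials with
    eigenvalue i ([freq] - [w j]). [ptrunc] drops degree one, where [Leaf j] has eigenvalue 0. *)
Definition Linv (w : 'I_n -> R) N j p : tpoly :=
  [seq (a.1 / (0 +i* (freq w (leaves a.2) - w j))%C, a.2) | a <- ptrunc N p].

(** Iterates of the truncated conjugacy equation H = id + Linv (f o H), started at H = id. *)
Fixpoint Hiter (w : 'I_n -> R) N (f : 'I_n -> seq (R[i] * word)) k (j : 'I_n) : tpoly :=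
  (1, Leaf j) :: (if k is k'.+1 then Linv w N j (psubst (f j) (Hiter w N f k')) else [::]).

Lemma wev_pmul p q z : wev (flat (pmul p q)) z = wev (flat p) z * wev (flat q) z.
Proof.
rewrite /wev !big_map big_allpairs_dep mulr_suml; apply: eq_bigr => a _.
rewrite mulr_sumr; apply: eq_bigr => b _ /=.
by rewrite big_cat/= mulrACA.
Qed.

Lemma wev_pw H s z : (0 < size s)%N ->
  wev (flat (pw H s)) z = \prod_(i <- s) wev (flat (H i)) z.
Proof.
elim: s => // i [|i' s] IH _; first by rewrite big_seq1.
by rewrite big_cons -IH// -wev_pmul.
Qed.

Lemma wev_tscale c p z : wev (flat (tscale c p)) z = c * wev (flat p) z.
Proof. by rewrite /wev !big_map mulr_sumr; apply: eq_bigr => a _; rewrite mulrA. Qed.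

Lemma wev_psubst f H z : (forall c, c \in f -> (0 < size c.2)%N) ->
  wev (flat (psubst f H)) z = wev f (fun i => wev (flat (H i)) z).
Proof.
elim: f => [|c f IH] hf; first by rewrite /wev !big_nil.
rewrite /psubst /= /flat map_cat -/(flat _) wev_cat wev_tscale.
rewrite -/(psubst f H) -/(flat (psubst f H)) IH; last by move=> d df; apply: hf; rewrite in_cons df orbT.
by rewrite [in RHS]/wev big_cons wev_pw// hf// mem_head.
Qed.

Lemma tnorm_pmul W' W p q : (forall a b, W' (Node a b) <= W a * W b) ->
  tnorm W' (pmul p q) <= tnorm W p * tnorm W q.
Proof.
move=> hW; rewrite /tnorm big_allpairs_dep mulr_suml; apply: ler_sum => a _.
rewrite mulr_sumr; apply: ler_sum => b _ /=.
by rewrite cabsM mulrACA ler_wpM2l// mulr_ge0 ?cabs_ge0.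
Qed.

Lemma tnorm_ge0 W p : (forall t, 0 <= W t) -> 0 <= tnorm W p.
Proof. by move=> W0; apply: sumr_ge0 => c _; rewrite mulr_ge0 ?cabs_ge0. Qed.

Lemma tnorm_pw W H s X : (forall t, 0 <= W t) -> (forall a b, W (Node a b) <= W a * W b) ->
  (forall i, tnorm W (H i) <= X) -> (0 < size s)%N -> tnorm W (pw H s) <= X ^+ size s.
Proof.
move=> W0 hW hX; elim: s => // i [|i' s] IH _; first by rewrite expr1 hX.
apply: (le_trans (tnorm_pmul _ _ hW)).
by rewrite [size _]/= exprS ler_pM ?tnorm_ge0// IH.
Qed.

(** A product of two or more factors has a [Node] on top of each term, so [W'] is constrained only
    there; this admits a [W'] that leaves out the divisor of the top node. *)
Lemma tnorm_pw2 W' W H s X : (forall t, 0 <= W t) -> (forall a b, W (Node a b) <= W a * W b) ->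
  (forall a b, W' (Node a b) <= W a * W b) ->
  (forall i, tnorm W (H i) <= X) -> (1 < size s)%N -> tnorm W' (pw H s) <= X ^+ size s.
Proof.
move=> W0 hW hW' hX; case: s => [//|i [//|i' s]] _.
apply: (le_trans (tnorm_pmul _ _ hW')).
rewrite [size _]/= exprS; apply: ler_pM; rewrite ?tnorm_ge0//; exact: (@tnorm_pw W H (i' :: s)).
Qed.

Lemma tnorm_tscale W c p : tnorm W (tscale c p) = cabs c * tnorm W p.
Proof. by rewrite /tnorm big_map mulr_sumr; apply: eq_bigr => a _; rewrite cabsM mulrA. Qed.

Lemma tnorm_psubst W' W H f X : (forall t, 0 <= W t) -> (forall a b, W (Node a b) <= W a * W b) ->
  (forall a b, W' (Node a b) <= W a * W b) ->
  (forall i, tnorm W (H i) <= X) -> (forall c, c \in f -> (1 < size c.2)%N) ->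
  tnorm W' (psubst f H) <= wnorm X f.
Proof.
move=> W0 hW hW' hX hf; rewrite /tnorm /psubst big_flatten big_map /wnorm.
rewrite big_seq [leRHS]big_seq; apply: ler_sum => c cf.
rewrite -/(tnorm W' _) tnorm_tscale ler_wpM2l ?cabs_ge0//.
by apply: (tnorm_pw2 (W := W)) => //; exact: hf.
Qed.

(* [eps] bounds the small divisors from below; a node of weight [eps * W a * W b]
   pays for the division at that node. *)
Lemma tnorm_Linv_psubst w N j W eps H f X : (forall t, 0 <= W t) ->
  (forall t, 0 <= eps t <= 1) ->
  (forall a b, W (Node a b) = eps (Node a b) * (W a * W b)) ->
  (forall t, (1 < tsize t <= N)%N -> eps t <= `|freq w (leaves t) - w j|) ->
  (forall i, tnorm W (H i) <= X) -> (forall c, c \in f -> (1 < size c.2)%N) ->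
  tnorm W (Linv w N j (psubst f H)) <= wnorm X f.
Proof.
move=> W0 e01 hW he hX hf.
pose W' t := if t is Node a b then W a * W b else 0.
have hW1 a b : W (Node a b) <= W a * W b.
  by rewrite hW ler_piMl ?mulr_ge0//; have /andP[] := e01 (Node a b).
apply: le_trans (@tnorm_psubst W' W H f X W0 hW1 _ hX hf); last by move=> a b /=.
have W'0 t : 0 <= W' t by case: t => //= a b; rewrite mulr_ge0.
rewrite /tnorm big_map /= /ptrunc big_filter big_mkcond/=; apply: ler_sum => -[c t] _ /=.
case: ifPn => [ht|_]; last by rewrite mulr_ge0 ?cabs_ge0.
case: t ht => [i|a b] ht; first by rewrite /tsize/= in ht.
have {}he := he _ ht.
rewrite hW cabsM cabsV cabs_imag [W' _]/= -mulrA ler_wpM2l ?cabs_ge0//.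
rewrite mulrA ler_piMl ?mulr_ge0//.
(* A zero divisor has inverse 0 by convention and contributes nothing. *)
have [->|d0] := eqVneq (`|freq w (leaves (Node a b)) - w j|) 0; first by rewrite invr0 mul0r.
by rewrite ler_pdivrMl ?mulr1// lt_neqAle eq_sym d0 normr_ge0.
Qed.

Definition tfilt d p : tpoly := [seq a <- p | (tsize a.2 <= d)%N].

(** Each factor has at least one leaf, so a term with more than d leaves cannot enter a product with
    d + 1 leaves. This gain of one degree makes the iteration stabilise. *)
Lemma tfilt_pmul d p q : tfilt d.+1 (pmul p q) = tfilt d.+1 (pmul (tfilt d p) (tfilt d q)).
Proof.
have cat r r' : tfilt d.+1 (r ++ r') = tfilt d.+1 r ++ tfilt d.+1 r' by rewrite /tfilt filter_cat.
have cons a r r' : pmul (a :: r) r' = [seq (a.1 * b.1, Node a.2 b.2) | b <- r'] ++ pmul r r' by [].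
elim: p => // a p IH; rewrite cons cat IH [tfilt d (a :: p)]/=.
case: ifPn => ha.
  rewrite cons cat; congr (_ ++ _).
  rewrite /tfilt !filter_map -filter_predI; congr (map _ _); apply: eq_filter => b /=.
  by rewrite tsize_Node; have := tsize_gt0 a.2; lia.
rewrite /tfilt filter_map (eq_filter (a2 := pred0)) ?filter_pred0// => -[c t]; rewrite /preim /=.
by rewrite tsize_Node; have := tsize_gt0 t; move: ha; lia.
Qed.

Lemma tfilt_weak d e p q : (d <= e)%N -> tfilt e p = tfilt e q -> tfilt d p = tfilt d q.
Proof.
move=> de h.
have E r : tfilt d r = tfilt d (tfilt e r).
  rewrite /tfilt -filter_predI; apply: eq_filter => a /=.
  by case: leqP => //= /leq_trans ->.
by rewrite E h -E.
Qed.

Lemma tfilt_pw d H H' s : (forall i, tfilt d (H i) = tfilt d (H' i)) ->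
  tfilt d (pw H s) = tfilt d (pw H' s).
Proof.
move=> h; elim: s => // i [|i' s] IH; first exact: h.
apply: (@tfilt_weak d d.+1) => //; rewrite [LHS]tfilt_pmul [RHS]tfilt_pmul.
by rewrite h IH.
Qed.

Lemma tfilt_pw2 d H H' s : (forall i, tfilt d (H i) = tfilt d (H' i)) -> (1 < size s)%N ->
  tfilt d.+1 (pw H s) = tfilt d.+1 (pw H' s).
Proof.
move=> h; case: s => [//|i [//|i' s]] _; rewrite [LHS]tfilt_pmul [RHS]tfilt_pmul.
by rewrite h (tfilt_pw (i' :: s) h).
Qed.

Lemma tfilt_psubst d H H' f : (forall i, tfilt d (H i) = tfilt d (H' i)) ->
  (forall c, c \in f -> (1 < size c.2)%N) -> tfilt d.+1 (psubst f H) = tfilt d.+1 (psubst f H').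
Proof.
move=> h; elim: f => // c f IH hf; rewrite /psubst/= /tfilt !filter_cat.
congr (_ ++ _); last by apply: IH => e ef; apply: hf; rewrite in_cons ef orbT.
by rewrite !filter_map; congr (map _ _); apply: tfilt_pw2 => //; apply: hf; rewrite mem_head.
Qed.

Lemma tfilt_Linv w N d j p q : tfilt d p = tfilt d q ->
  tfilt d (Linv w N j p) = tfilt d (Linv w N j q).
Proof.
move=> h; rewrite /tfilt /Linv !filter_map; congr map.
have E r : [seq x <- ptrunc N r | (tsize x.2 <= d)%N] = ptrunc N (tfilt d r).
  by rewrite /ptrunc /tfilt -!filter_predI; apply: eq_filter => a /=; rewrite andbC.
by rewrite !E h.
Qed.

Lemma Hiter_step w N (f : 'I_n -> seq (R[i] * word)) k j : (forall i c, c \in f i -> (1 < size c.2)%N) ->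
  tfilt k.+1 (Hiter w N f k j) = tfilt k.+1 (Hiter w N f k.+1 j).
Proof.
move=> hf; elim: k j => [|k IH] j.
  rewrite /= /tfilt/= filter_map -filter_predI (eq_filter (a2 := pred0)) ?filter_pred0//.
  by move=> a /=; case: (tsize a.2) => [|[|m]].
have E : tfilt k.+2 (psubst (f j) (Hiter w N f k)) = tfilt k.+2 (psubst (f j) (Hiter w N f k.+1)).
  by apply: tfilt_psubst => //; exact: hf.
by have := tfilt_Linv w N j E; rewrite /= /tfilt /= => ->.
Qed.

Lemma all_Linv w N j p : all (fun c => 1 < tsize c.2 <= N)%N (Linv w N j p).
Proof. by rewrite all_map -(eq_all (a1 := fun c => 1 < tsize c.2 <= N)%N)// filter_all. Qed.

Lemma Hiter_size w N (f : 'I_n -> seq (R[i] * word)) k j : (0 < N)%N -> all (fun c => tsize c.2 <= N)%N (Hiter w N f k j).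
Proof.
move=> N0; case: k => [|k]; rewrite /= ?N0//.
by apply: sub_all (all_Linv _ _ _ _) => c /andP[].
Qed.

(** Round k has settled all trees with at most k + 1 leaves, and the truncation keeps none with more
    than N, so round N solves the conjugacy equation exactly, as an equality of lists. *)
Lemma Hiter_fixed w N (f : 'I_n -> seq (R[i] * word)) j : (forall i c, c \in f i -> (1 < size c.2)%N) -> (0 < N)%N ->
  Hiter w N f N j = (1, Leaf j) :: Linv w N j (psubst (f j) (Hiter w N f N)).
Proof.
move=> hf N0; have := @Hiter_step w N f N j hf.
have E k : tfilt N.+1 (Hiter w N f k j) = Hiter w N f k j.
  by apply/all_filterP; apply: sub_all (Hiter_size w f k j N0) => c /leq_trans ->.
by rewrite !E => ->.
Qed.

End TreePolynomials.

(** * Small divisors along trees *)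

Section Counting.
Variables (R : realType) (n : nat) (w : 'I_n -> R).
Local Notation tree := (tree n).
Implicit Types (t a b : tree) (c : seq 'I_n).

Fixpoint nodes t : nat := if t is Node a b then (nodes a + nodes b).+1 else 0%N.

Lemma tsize_nodes t : tsize t = (nodes t).+1.
Proof. by elim: t => // a Ha b Hb; rewrite tsize_Node Ha Hb /= addSn addnS. Qed.

Fixpoint cost (e : tree -> R) t : R := if t is Node a b then e t + (cost e a + cost e b) else 0.

Definition count (sm : tree -> bool) t : R := cost (fun s => (sm s)%:R) t.

(* [phi] bounds the contribution of the side branches hanging off the path that joins two nested
   small divisors; the last hypothesis says how far apart (by a word c) these must be. *)
Lemma count_le (sm : tree -> bool) (g phi : nat -> R) :
  0 <= g 0%N -> 0 <= phi 0%N ->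
  (forall i j, g i + g j <= g (i + j).+1) ->
  (forall i j, [\/ g i <= phi i, g j <= phi j |
     forall x, 1 + g i + g j + phi x.-1 <= g (i + j + x).+1]) ->
  (forall i j, phi i.-1 + phi j <= phi (i + j)%N) ->
  (forall t, sm t -> 1 + phi (nodes t).-1 <= g (nodes t)) ->
  (forall s t c, sm s -> sm t ->
     freq w (leaves s) = freq w (leaves t) + freq w c ->
     nodes s = (nodes t + size c)%N -> (0 < size c)%N ->
     g (nodes t) + 1 + phi (size c).-1 <= g (nodes s)) ->
  forall t, count sm t <= g (nodes t).
Proof.
move=> g0 p0 gD gphi phiD root gap t.
have [m] := ubnP (nodes t); elim: m t => // m IH [i|a b] /= hm; first by rewrite /count.
have IHa : count sm a <= g (nodes a) by apply: IH; lia.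
have IHb : count sm b <= g (nodes b) by apply: IH; lia.
rewrite /count [cost _ _]/= -/(count sm a) -/(count sm b).
case: (boolP (sm (Node a b))) => hs; last first.
  by rewrite add0r (le_trans _ (gD _ _))// lerD.
set s := Node a b in hs *.
have ns : nodes s = (nodes a + nodes b).+1 by [].
rewrite -ns.
(* State of a descent from the small node [s]: the subtrees [b1] and [b2] remain, [c] collects the
   leaves hanging off the path. A branch with [g <= phi] is absorbed into [c] and the descent goes
   on in the other; if there is none, the third alternative of [gphi] pays for [s] and both
   branches. *)
have split b1 b2 c : (nodes b1 < nodes s)%N -> (nodes b2 < nodes s)%N ->
  (forall c', freq w (leaves s) = freq w (leaves b1) + freq w c' ->
     nodes s = (nodes b1 + size c')%N -> (0 < size c')%N ->
     1 + count sm b1 + phi (size c').-1 <= g (nodes s)) ->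
  (forall c', freq w (leaves s) = freq w (leaves b2) + freq w c' ->
     nodes s = (nodes b2 + size c')%N -> (0 < size c')%N ->
     1 + count sm b2 + phi (size c').-1 <= g (nodes s)) ->
  freq w (leaves s) = freq w (leaves b1) + freq w (leaves b2) + freq w c ->
  nodes s = (nodes b1 + nodes b2 + size c).+1 ->
  1 + count sm b1 + count sm b2 + phi (size c).-1 <= g (nodes s).
  move=> l1 l2 h1 h2 hf hn.
  have c1 : count sm b1 <= g (nodes b1) by apply: IH; lia.
  have c2 : count sm b2 <= g (nodes b2) by apply: IH; lia.
  have fcat x : freq w (x ++ c) = freq w x + freq w c by rewrite /freq big_cat.
  case: (gphi (nodes b1) (nodes b2)) => [l|l|/(_ (size c))].
  - have := h2 (leaves b1 ++ c); rewrite size_cat -/(tsize b1) tsize_nodes fcat => /(_ _ _ _).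
    have := phiD (size c) (nodes b1); rewrite addSn/= addnC => hp h.
    by have := h ltac:(by rewrite hf; ring) ltac:(lia) isT; lra.
  - have := h1 (leaves b2 ++ c); rewrite size_cat -/(tsize b2) tsize_nodes fcat => /(_ _ _ _).
    have := phiD (size c) (nodes b2); rewrite addSn/= addnC => hp h.
    by have := h ltac:(by rewrite hf; ring) ltac:(lia) isT; lra.
  - by rewrite -hn; lra.
(* The descent into [t] ends at a leaf, where [root] applies, or at the next small node, where [gap]
   does. *)
have sub t c : (nodes t < nodes s)%N -> freq w (leaves s) = freq w (leaves t) + freq w c ->
     nodes s = (nodes t + size c)%N -> (0 < size c)%N ->
     1 + count sm t + phi (size c).-1 <= g (nodes s).
  elim: t c => [i|b1 H1 b2 H2] c hl hf hn hc.
    by have := root _ hs; rewrite hn add0n /count/= addr0.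
  case: (boolP (sm (Node b1 b2))) => hs2.
    have := gap s (Node b1 b2) c hs hs2 hf hn hc.
    have : count sm (Node b1 b2) <= g (nodes (Node b1 b2)) by apply: IH; move: hl ns hm; lia.
    lra.
  rewrite /count [cost _ _]/= (negbTE hs2) add0r addrA -/(count sm b1) -/(count sm b2).
  have E : (nodes (Node b1 b2) = (nodes b1 + nodes b2).+1)%N by [].
  rewrite E in hl hn.
  apply: split; try lia.
  - by move=> c' e1 e2 e3; apply: (H1 c' _ e1 e2 e3); move: hl; lia.
  - by move=> c' e1 e2 e3; apply: (H2 c' _ e1 e2 e3); move: hl; lia.
  - by rewrite hf /= /freq big_cat.
have := split a b [::]; rewrite addn0 addrA.
have na : (nodes a < nodes s)%N by rewrite ns; lia.
have nb : (nodes b < nodes s)%N by rewrite ns; lia.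
move=> /(_ na nb (fun c => @sub a c na) (fun c => @sub b c nb)) h.
have := h ltac:(by rewrite /s /= /freq big_cat big_nil addr0) ns.
rewrite /=; lra.
Qed.

Lemma costD e1 e2 t : cost (fun s => e1 s + e2 s) t = cost e1 t + cost e2 t.
Proof. by elim: t => [i|a Ha b Hb] /=; [rewrite addr0|rewrite Ha Hb; ring]. Qed.

Lemma costZ (k : R) e t : cost (fun s => e s * k) t = cost e t * k.
Proof. by elim: t => [i|a Ha b Hb] /=; [rewrite mul0r|rewrite Ha Hb; ring]. Qed.

Lemma cost_const (k : R) t : cost (fun=> k) t = (nodes t)%:R * k.
Proof. by elim: t => [i|a Ha b Hb] /=; [rewrite mul0r|rewrite Ha Hb -addn1 !natrD; ring]. Qed.

Lemma cost_sum K (e : nat -> tree -> R) t :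
  cost (fun s => \sum_(m < K) e m s) t = \sum_(m < K) cost (e m) t.
Proof.
elim: K => [|K IH].
  rewrite (_ : (fun s => _) = fun=> 0) ?cost_const ?mulr0 ?big_ord0//.
  by apply/funext => s; rewrite big_ord0.
rewrite big_ord_recr /= -IH -costD; congr (cost _ t).
by apply/funext => s; rewrite big_ord_recr.
Qed.

Fixpoint tprod (eps : tree -> R) t : R :=
  if t is Node a b then eps t * (tprod eps a * tprod eps b) else 1.

(* Writes a small divisor as a product of ratios of consecutive thresholds l, so that each scale
   is charged only by the divisors below it. *)
Lemma step_telescope (l : nat -> R) (x : R) K :
  l 0%N - \sum_(m < K) (x < l m)%R%:R * (l m - l m.+1) <= Num.max x (l K).
Proof.
elim: K => [|K IH]; first by rewrite big_ord0 subr0 le_max lexx orbT.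
rewrite big_ord_recr /= le_max.
move: IH; rewrite le_max; case: ltP => h.
  by move=> /orP[] IH; apply/orP; right; rewrite mul1r; lra.
by move=> /orP[] IH; apply/orP; left; rewrite mul0r; lra.
Qed.

(** Summing the telescoped logarithms over the nodes and exchanging the sums leaves one node count
    per threshold. The maximum with [l K] disappears because no divisor of degree at most N lies
    below it. *)
Lemma tprod_ge (eps : tree -> R) (l kap : nat -> R) (K N : nat) :
  (forall t, (1 < tsize t)%N -> 0 < eps t) -> l 0%N <= 0 -> (forall m, l m.+1 <= l m) ->
  (forall t, (1 < tsize t <= N)%N -> l K <= ln (eps t)) ->
  (forall t m, (m < K)%N -> (tsize t <= N)%N ->
     count (fun t => ln (eps t) < l m) t <= kap m * (nodes t)%:R) ->
  forall t, (tsize t <= N)%N ->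
    expR (- (nodes t)%:R * (- l 0%N + \sum_(m < K) kap m * (l m - l m.+1))) <= tprod eps t.
Proof.
move=> eps0 l0 lmono lK hcount t tN.
pose e t := - l 0%N + \sum_(m < K) (ln (eps t) < l m)%R%:R * (l m - l m.+1).
have h1 : expR (- cost e t) <= tprod eps t.
  elim: t tN => [i|a Ha b Hb] tN; first by rewrite /= oppr0 expR0.
  rewrite [tprod _ _]/= [cost _ _]/= (opprD (e _)) expRD (opprD (cost e a)) (expRD (- cost e a)).
  rewrite tsize_Node in tN.
  have ta := tsize_gt0 a; have tb := tsize_gt0 b.
  apply: ler_pM; rewrite ?mulr_ge0 ?expR_ge0//; last first.
    by apply: ler_pM; rewrite ?expR_ge0//; [apply: Ha|apply: Hb]; lia.
  have s1 : (1 < tsize (Node a b))%N by rewrite tsize_Node; lia.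
  rewrite -[leRHS]lnK ?posrE ?eps0// ler_expR /e opprD opprK.

  have := step_telescope l (ln (eps (Node a b))) K.
  rewrite (max_idPl _)//; apply: lK; rewrite s1 tsize_Node; lia.
apply: le_trans h1; rewrite ler_expR mulNr lerN2.
rewrite /e costD cost_const mulrDr lerD2l (cost_sum K (fun m s => (ln (eps s) < l m)%R%:R * (l m - l m.+1))) mulr_sumr; apply: ler_sum => m _.
rewrite (costZ _ (fun s => (ln (eps s) < l m)%R%:R)) mulrA ler_wpM2r ?subr_ge0//.
by rewrite mulrC; apply: hcount.
Qed.

End Counting.

Arguments count {R n} sm t.

(** * Bruno's counting lemma and the divisor bound *)

Section SmallDivisors.
Variables (R : realType) (n : nat) (w : 'I_n -> R).
Local Notation tree := (tree n).
Implicit Types (t a b : tree) (c : seq 'I_n).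

Lemma freq_cons i c : freq w (i :: c) = w i + freq w c.
Proof. by rewrite /freq big_cons. Qed.

Lemma msize_count c : msize (fun j => count_mem j c) = size c.
Proof.
elim: c => [|i c IH] /=; first by rewrite /msize big1.
rewrite -IH /msize big_split/= -add1n; congr addn.
by rewrite (bigD1 i)//= eqxx big1 ?addn0// => j /negbTE; rewrite eq_sym => ->.
Qed.

Lemma adot_count c : adot (fun j => count_mem j c) w = freq w c.
Proof.
elim: c => [|i c IH] /=; first by rewrite /adot /freq big_nil big1// => j _; rewrite mul0r.
rewrite freq_cons -IH /adot; under eq_bigr do rewrite natrD mulrDl.
rewrite big_split/=; congr (_ + _).
by rewrite (bigD1 i)//= eqxx mul1r big1 ?addr0// => j /negbTE; rewrite eq_sym => ->; rewrite mul0r.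
Qed.

Definition small_divisor (dlt : R) t : bool :=
  (1 < tsize t)%N && [exists j, `|freq w (leaves t) - w j| < dlt].

(** Two nested small divisors differ by [w j' + freq w c - w j], which is then below [2 * dlt], so
    the word [c] between them has at least p - 1 letters. Likewise a small divisor sits on at least
    p leaves. *)
Lemma count_small_le (p : nat) (dlt : R) t : (1 < p)%N -> 0 < dlt ->
  (forall c j, (1 < size c < p)%N -> 2 * dlt <= `|freq w c - w j|) ->
  (count (small_divisor dlt) t : R) <= 2 / p%:R * (nodes t)%:R.
Proof.
move=> p2 d0 hp.
have p0 : (p%:R : R) != 0 by rewrite pnatr_eq0; lia.
pose G (x : nat) : R := x%:R / p%:R.
have GD x y : G (x + y)%N = G x + G y by rewrite /G natrD mulrDl.
pose e : R := p%:R^-1.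
have GS x : G x.+1 = G x + e by rewrite /G -natr1 mulrDl mul1r.
have G1 : 0 <= e /\ 2 * e <= 1.
  rewrite /e; split; first by rewrite invr_ge0.
  by rewrite ler_pdivrMr ?ltr0n; [rewrite mul1r ler_nat|lia].
have Gp x : (p <= x)%N -> 1 <= G x.
  by move=> px; rewrite /G ler_pdivlMr ?ltr0n; [rewrite mul1r ler_nat|lia].
have G0 x : 0 <= G x by rewrite /G divr_ge0.
(* The offset -1 lets a small node join two expensive branches; the slope 2/p then gives at least 1
   at p leaves, and [2 * (p - 1) >= p] covers a gap of p - 1 letters. *)
pose g (x : nat) : R := if (x.+1 < p)%N then 0 else 2 * G x.+1 - 1.
pose phi (_ : nat) : R := 0.
have large s : small_divisor dlt s -> (p <= (nodes s).+1)%N.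
  move=> /andP[s1 /existsP[j hj]]; rewrite leqNgt -tsize_nodes; apply/negP => hs.
  by have := hp (leaves s) j; rewrite -/(tsize s) s1 hs => /(_ isT); lra.
apply: le_trans (@count_le R n w (small_divisor dlt) g phi _ _ _ _ _ _ _ t) _ => //.
- by rewrite /g p2.
- move=> i j; rewrite /g; have hG := Gp (i + j).+2; rewrite !GS GD in hG; rewrite !GS GD.
  move: (G0 i) (G0 j) G1 => ? ? [? ?].
  by case: (ltnP i.+1 p) => hi; case: (ltnP j.+1 p) => hj; case: (ltnP (i + j).+2 p) => hij;
    try lia; try (have {}hG := hG ltac:(lia)); lra.
- move=> i j; rewrite /g /phi; case: ltnP => hi; first by apply: Or31.
  case: ltnP => hj; first by apply: Or32.
  apply: Or33 => x; rewrite ifF; last by lia.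
  rewrite !GS !GD; move: (G0 x) G1 => ? [? ?]; lra.
- by move=> *; rewrite /phi addr0.
- move=> s /large hs; rewrite /phi addr0 /g ifF; last by lia.
  by have := Gp _ hs; lra.
- move=> s u c ss su hf hn hc; have ls := large _ ss; have lu := large _ su.
  rewrite /phi addr0 /g !ifF; try lia.
  move: ss su => /andP[_ /existsP[j hj]] /andP[_ /existsP[j' hj']].
  have hcp : (p <= (size c).+1)%N.
    rewrite leqNgt; apply/negP => h.
    have := hp (j' :: c) j; rewrite /= h ltnS hc => /(_ isT); rewrite freq_cons.
    have -> : w j' + freq w c - w j = (freq w (leaves s) - w j) - (freq w (leaves u) - w j') by rewrite hf; ring.
    by have := ler_normB (freq w (leaves s) - w j) (freq w (leaves u) - w j'); lra.
  rewrite hn -addSn GD.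
  have : 1 <= G (size c + size c)%N by apply: Gp; lia.
  by rewrite GD; lra.
- rewrite /g; case: ifP => _; first by rewrite mulr_ge0.
  rewrite GS (_ : 2 / p%:R * (nodes t)%:R = 2 * G (nodes t)); last by rewrite /G; field.
  by case: G1; lra.
Qed.

(** A tree does not record which component was divided at a node, hence the minimum over j. The cap
    at 1 makes it harmless to charge also those nodes of a product at which no division took
    place. *)
Definition small_eps t : R := \big[Num.min/1]_(j < n) `|freq w (leaves t) - w j|.

Lemma small_eps_le1 t : small_eps t <= 1.
Proof. by rewrite /small_eps; elim/big_rec: _ => // i x _ h; rewrite ge_min h orbT. Qed.

Lemma small_eps_ge0 t : 0 <= small_eps t.
Proof. by rewrite /small_eps; elim/big_ind: _ => // x y hx hy; rewrite le_min hx. Qed.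

Lemma small_eps_le t j : small_eps t <= `|freq w (leaves t) - w j|.
Proof. by rewrite /small_eps (bigD1 j)//= ge_min lexx. Qed.

Lemma le_small_eps t d : d <= 1 -> (forall j, d <= `|freq w (leaves t) - w j|) -> d <= small_eps t.
Proof. by move=> d1 h; rewrite /small_eps; elim/big_ind: _ => // x y hx hy; rewrite le_min hx. Qed.

Lemma small_eps_gt0 t : nonresonant w -> (1 < tsize t)%N -> 0 < small_eps t.
Proof.
move=> nr t1; rewrite /small_eps; elim/big_ind: _ => // [x y hx hy|j _]; first by rewrite lt_min hx.
rewrite normr_gt0 subr_eq0; apply/eqP; rewrite -adot_count; apply: nr.
by rewrite msize_count.
Qed.

Lemma count_ln_small (d : R) t : nonresonant w -> 0 < d <= 1 ->
  (count (fun t => ln (small_eps t) < ln d) t : R) = count (small_divisor d) t.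
Proof.
move=> nr /andP[d0 d1]; rewrite /count; elim: t => //= a -> b ->; congr (_ + _); congr (_%:R).
set s := Node a b; have s1 : (1 < tsize s)%N.
  by rewrite /s tsize_Node; have := tsize_gt0 a; have := tsize_gt0 b; lia.
rewrite ltr_ln ?posrE ?small_eps_gt0// /small_divisor s1 /=; congr nat_of_bool.
apply/idP/existsP => [h|[j hj]]; last by apply: le_lt_trans hj; exact: small_eps_le.
apply: contrapT => hn; move: h; apply/negP; rewrite -leNgt; apply: le_small_eps => // j.
by rewrite leNgt; apply/negP => hj; apply: hn; exists j.
Qed.

Definition divisor_bound (s : R) : Prop := exists C : R, 1 <= C /\ exists N1 : nat,
  forall N, (N1 <= N)%N -> (0 < N)%N -> forall t, (tsize t <= N)%N ->
  ((C * powR N%:R s) ^+ nodes t)^-1 <= tprod small_eps t.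

(** The thresholds, the densities and their number may depend on N; only [B] and [N1] are uniform,
    and exp |B| becomes the constant. The last condition bounds the logarithmic cost per node after
    Abel summation. *)
Lemma divisor_bound_of_levels (s : R) : nonresonant w ->
  (exists (B : R) (N1 : nat), forall N, (N1 <= N)%N -> (0 < N)%N ->
    exists (K : nat) (d kap : nat -> R),
      [/\ (forall m, 0 < d m <= 1), (forall m, d m.+1 <= d m),
        (forall c j, (1 < size c <= N)%N -> d K <= `|freq w c - w j|),
        (forall t m, (m < K)%N -> (tsize t <= N)%N ->
          (count (small_divisor (d m)) t : R) <= kap m * (nodes t)%:R) &
        - ln (d 0%N) + \sum_(m < K) kap m * (ln (d m) - ln (d m.+1)) <= B + s * ln N%:R]) ->
  divisor_bound s.
Proof.
move=> nr [B [N1 h]]; exists (expR `|B|); split; first by rewrite -expR0 ler_expR.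
exists N1 => N hN N0 t tN; have [K [d [kap [d01 dmono dK hc hB]]]] := h N hN N0.
apply: le_trans (@tprod_ge _ _ small_eps (fun m => ln (d m)) kap K N _ _ _ _ _ t tN).
- rewrite /powR ifF; last by apply/negbTE; rewrite pnatr_eq0; lia.
  rewrite -expRD -expRM_natl -expRN ler_expR mulNr lerN2 ler_wpM2l//.
  by apply: (le_trans hB); rewrite lerD2r ler_norm.
- by move=> u; apply: small_eps_gt0.
- by rewrite ln_le0//; have /andP[] := d01 0%N.
- by move=> m; rewrite ler_ln ?posrE//; [have /andP[] := d01 m.+1|have /andP[] := d01 m].
- move=> u /andP[u1 uN]; rewrite ler_ln ?posrE ?small_eps_gt0//; last by have /andP[] := d01 K.
  by apply: le_small_eps => [|j]; [have /andP[] := d01 K|apply: dK; rewrite u1].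
- by move=> u m mK uN; rewrite count_ln_small//; exact: hc.
Qed.

End SmallDivisors.

(** * The Bruno-s condition *)

Section BrunoCondition.
Variables (R : realType) (n : nat) (w : 'I_n -> R).

Lemma Omega_le (p : nat) (a : 'I_n -> nat) j : (2 <= msize a < p)%N ->
  Omega w p <= `|adot a w - w j|.
Proof.
move=> ha; apply: inf_lbound => /=; last by exists a, j.
by exists 0 => _ [b [i [_ ->]]].
Qed.

Lemma Omega_set_neq0 p : (0 < n)%N -> (3 <= p)%N ->
  [set x : R | exists (a : 'I_n -> nat) (j : 'I_n),
         (2 <= msize a < p)%N /\ x = `|adot a w - w j|] !=set0.
Proof.
move=> n0 p3; pose i0 := Ordinal n0; pose a (j : 'I_n) := if j == i0 then 2%N else 0%N.
exists `|adot a w - w i0|, a, i0; split => //.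
by rewrite /msize (bigD1 i0)//= /a eqxx big1 ?addn0 ?p3// => j /negbTE ->.
Qed.

Lemma Omega_anti p q : (0 < n)%N -> (3 <= p <= q)%N -> Omega w q <= Omega w p.
Proof.
move=> n0 /andP[p3 pq]; apply: lb_le_inf; first exact: Omega_set_neq0.
move=> _ [a [j [/andP[a2 ap] ->]]]; apply: Omega_le.
by rewrite a2 (leq_trans ap).
Qed.

(** The infimum is over a finite set: the entries of [a] are below p, so non-resonance gives a
    positive minimum over a finite type. *)
Lemma Omega_gt0 p : (0 < n)%N -> nonresonant w -> (3 <= p)%N -> 0 < Omega w p.
Proof.
move=> n0 nr p3.
pose d := \big[Num.min/1]_(bj : {ffun 'I_n -> 'I_p} * 'I_n |
  (2 <= msize (fun j => bj.1 j : nat))%N) `|adot (fun j => bj.1 j : nat) w - w bj.2|.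
have d0 : 0 < d.
  rewrite /d; elim/big_ind: _ => // [x y hx hy|[b j] hb]; first by rewrite lt_min hx.
  by rewrite normr_gt0 subr_eq0; apply/eqP/nr.
apply: (lt_le_trans d0); apply: lb_le_inf; first exact: Omega_set_neq0.
move=> _ [a [j [/andP[a2 ap] ->]]].
have alt i : (a i < p)%N.
  by apply: leq_ltn_trans ap; rewrite /msize (bigD1 i)//= leq_addr.
pose b := [ffun i => Ordinal (alt i)].
have E : (fun j => b j : nat) = a by apply/funext => i; rewrite ffunE.
by rewrite /d (bigD1 (b, j)) /= ?E//= ge_min lexx.
Qed.

Lemma sum_le_support (x : nat -> R) m0 k : (forall m, 0 <= x m) ->
  (forall m, (m0 <= m)%N -> x m = 0) -> \sum_(m < k) x m <= \sum_(m < m0) x m.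
Proof.
move=> x0 xz; elim: k => [|k IH]; first by rewrite big_ord0 sumr_ge0.
case: (leqP m0 k) => h; first by rewrite big_ord_recr /= xz// addr0.
rewrite -!(big_mkord xpredT) (@big_cat_nat _ _ _ k.+1 0 m0)//= lerDl.
by rewrite sumr_ge0.
Qed.

Lemma Bruno_divisor_bound (s : R) : (0 < n)%N -> nonresonant w -> 0 < s -> Bruno w s ->
  divisor_bound w s.
Proof.
move=> n0 nr s0 [p [pS [p0 [p1 [M [N0 hB]]]]]].
apply: divisor_bound_of_levels => //.
have p3 m : (3 <= p m.+1)%N by elim: m => // m /leq_trans; apply; exact/ltnW/pS.
have pm m : (m <= p m)%N by elim: m => // m /leq_ltn_trans; apply; exact: pS.
have pgt m : (0 < p m)%N by case: m => // m; apply: leq_trans (p3 m).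
pose Om m := Num.min (Omega w (p m.+1)) 1.
have Om0 m : 0 < Om m by rewrite lt_min Omega_gt0//=.
have Om1 m : Om m <= 1 by rewrite ge_min lexx orbT.
have OmS m : Om m.+1 <= Om m.
  rewrite le_min Om1 andbT ge_min; apply/orP; left; apply: Omega_anti => //.
  by rewrite p3 ltnW.
have OmL c j m : (1 < size c < p m.+1)%N -> Om m <= `|freq w c - w j|.
  move=> hc; rewrite ge_min -adot_count; apply/orP; left.
  by apply: Omega_le; rewrite msize_count.
pose L m := - ln (Om m).
have L0 m : 0 <= L m by rewrite oppr_ge0 ln_le0.
(* Capping Omega at 1 changes the Bruno sum by a bounded amount only *)
have [B hL] : exists B, forall N k, (N0 <= N)%N -> (0 < N)%N -> (p k <= N < p k.+1)%N ->
    2 * (\sum_(m < k.+1) L m / (p m)%:R) <= B + s * ln N%:R.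
  (* [Omega] does not increase with p: once it is at most 1 the cap is inactive, so only the first
     [m0] terms change. If it never is, all capped terms vanish. *)
  case: (pselect (exists m0, Omega w (p m0.+1) <= 1)) => [[m0 hm0]|hno]; last first.
    exists 0 => N k _ N1 _; rewrite big1 ?mulr0 => [|m _].
      by rewrite add0r; apply: mulr_ge0; [exact: ltW|rewrite ln_ge0// ler1n].
    rewrite /L /Om min_r ?ln1 ?oppr0 ?mul0r//.
    by rewrite leNgt; apply/negP => h; apply: hno; exists m; exact: ltW.
  pose x m := (L m - ln ((Omega w (p m.+1))^-1)) / (p m)%:R.
  exists (M + 2 * \sum_(m < m0) x m) => N k hN N1 hk.
  have := @sum_le_support x m0 k.+1 _ _.
  have x0 m : 0 <= x m.
    rewrite /x divr_ge0// lnV ?posrE ?Omega_gt0// /L opprK addrC subr_ge0.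
    by rewrite ler_ln ?posrE ?Omega_gt0// ge_min lexx.
  have xz m : (m0 <= m)%N -> x m = 0.
    move=> hm; rewrite /x /L /Om min_l ?lnV ?posrE ?Omega_gt0// ?subrr ?mul0r//.
    apply: le_trans hm0; apply: Omega_anti => //; rewrite p3 /=.
    by elim: m hm => [|m IH]; rewrite leq_eqVlt => /predU1P[->//|] // /IH /leq_trans; apply; exact/ltnW/pS.
  move=> /(_ x0 xz).
  rewrite /x; under eq_bigr do rewrite mulrBl.
  rewrite sumrB => hs.
  pose a (j : 'I_n) := if j == Ordinal n0 then N else 0%N.
  have ha : msize a = N.
    by rewrite /msize (bigD1 (Ordinal n0))//= /a eqxx big1 ?addn0// => j /negbTE ->.
  have := hB a k; rewrite ha => /(_ hN hk).
  lra.
exists (- ln (Om 0%N / 2) + B), (maxn N0 (p 0%N)) => N hN N1.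
have [k hk] : exists k, (p k <= N < p k.+1)%N.
  have ex : exists k, (p k <= N)%N by exists 0%N; rewrite (leq_trans _ hN)// leq_maxr.
  have ub k : (p k <= N)%N -> (k <= N)%N by apply: leq_trans.
  case: (ex_maxnP ex ub) => k hk hmax; exists k; rewrite hk /= ltnNge; apply/negP => /hmax.
  by rewrite ltnn.
(* Divisors below [Om m / 2] have density [2 / p m.+1], and the logarithmic gap between thresholds m
   and m + 1 is at most [L m.+1]: level m yields term m + 1 of the Bruno sum, with its factor 2. *)
exists k, (fun m => Om m / 2), (fun m => 2 / (p m.+1)%:R); split.
- by move=> m; have := Om0 m; have := Om1 m => ? ?; apply/andP; split; lra.
- by move=> m; have := OmS m; lra.
- move=> c j /andP[c1 cN]; have /andP[_ hk2] := hk.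
  have := @OmL c j k; rewrite c1 (leq_ltn_trans cN hk2) => /(_ isT).
  by have := Om0 k; lra.
- move=> t m mk tN; apply: count_small_le; first by apply: ltnW.
    by rewrite divr_gt0.
  by move=> c j hc; rewrite mulrCA divff// mulr1; exact: OmL.
- rewrite -addrA lerD2l.
  apply: le_trans (hL N k _ N1 hk); last by rewrite (leq_trans _ hN)// leq_maxl.
  rewrite big_ord_recl mulrDr mulr_sumr.
  apply: (@le_trans _ _ (\sum_(i < k) 2 * (L (bump 0 i) / (p (bump 0 i))%:R))); last first.
    by rewrite lerDr mulr_ge0// divr_ge0.
  apply: ler_sum => m _; rewrite /bump leq0n add1n.
  rewrite -mulrA ler_wpM2l// mulrC ler_wpM2r ?invr_ge0// /L.
  rewrite !lnM ?posrE ?Om0 ?invr_gt0//.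
  by have := L0 m; rewrite /L; lra.
Qed.

End BrunoCondition.

(** * A finer count when small divisors occur at multiples *)

Section MultiplesCounting.
Variables (R : realType) (n : nat) (w : 'I_n -> R).
Local Notation tree := (tree n).
Implicit Types (t : tree) (c : seq 'I_n).

(* Davie-type count: below the scale q'/4 small divisors occur only at multiples of Q,
   which improves the generic factor 2/Q to 1/Q + O(1/q'). *)
Lemma count_small_multiples (Q q' : nat) (dlt : R) t : (0 < Q)%N -> (0 < q')%N -> 0 < dlt ->
  (forall c j j', (0 < size c)%N -> (4 * size c < q')%N ->
     `|w j' + freq w c - w j| < 2 * dlt -> (Q %| size c)%N) ->
  (count (small_divisor w dlt) t : R) <= (1 / Q%:R + 12 / q'%:R) * (nodes t)%:R.
Proof.
move=> Q0 q'0 d0 key.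
have QR : (0 : R) < Q%:R by rewrite ltr0n.
have q'R : (0 : R) < q'%:R by rewrite ltr0n.
pose G (x : nat) : R := x%:R / Q%:R.
pose D (x : nat) : R := 12 * (x%:R / q'%:R).
have GD x y : G (x + y)%N = G x + G y by rewrite /G natrD mulrDl.
have DD x y : D (x + y)%N = D x + D y by rewrite /D natrD; ring.
have G0 x : 0 <= G x by rewrite /G divr_ge0.
have D0 x : 0 <= D x by rewrite /D mulr_ge0// divr_ge0.
have GS x : G x <= G x.+1 by rewrite -addn1 GD; have := G0 1%N; lra.
have DS x : D x <= D x.+1 by rewrite -addn1 DD; have := D0 1%N; lra.
have D3 x : (q' <= 4 * x)%N -> 3 <= D x.
  move=> h; rewrite /D mulrA ler_pdivlMr//.
  have : (q'%:R : R) <= 4 * x%:R by rewrite -natrM ler_nat.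
  lra.
(* Number of multiples of [Q] up to x, the charge allowed below degree q'/4. From that degree on
   [D >= 3], whence 12 = 3 * 4, and this pays for the offset -1 in [g] and for the units still to be
   charged. *)
pose phi (x : nat) : R := (x %/ Q)%:R.
have phiG x : phi x <= G x by rewrite /phi /G ler_pdivlMr// -natrM ler_nat leq_divM.
have phi_ge0 x : 0 <= phi x by [].
have phiD x y : phi x + phi y <= phi (x + y)%N.
  by rewrite /phi -natrD ler_nat leq_divRL// mulnDl leq_add// leq_divM.
have phi_mono x y : (x <= y)%N -> phi x <= phi y by move=> h; rewrite ler_nat leq_div2r.
have phi_dvd x : (0 < x)%N -> (Q %| x)%N -> 1 + phi x.-1 <= phi x.
  move=> x0 /dvdnP[k xk]; rewrite -(natrD R 1) ler_nat add1n xk mulnK// ltn_divLR// -xk.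
  by rewrite prednK.
pose g (x : nat) : R := if (4 * x < q')%N then phi x else G x + D x - 1.
have g_small x : g x <= G x + D x.
  by rewrite /g; case: ifP => _; have := phiG x; have := D0 x; have := G0 x; lra.
have g_phi x y : g x + phi y <= g (x + y)%N.
  rewrite /g; case: ltnP => hx; case: ltnP => hxy.
  - exact: phiD.
  - by rewrite GD DD; have := D3 _ hxy; rewrite DD; have := phiG x; have := phiG y; lra.
  - lia.
  - by rewrite GD DD; have := phiG y; have := D0 y; lra.
have gS x : g x <= g x.+1.
  by have := g_phi x 1%N; rewrite addn1; have := phi_ge0 1%N; lra.
apply: le_trans (@count_le R n w (small_divisor w dlt) g phi _ _ _ _ _ _ _ t) _ => //.
- by rewrite /g muln0 q'0.
- move=> i j; apply: le_trans (gS _).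
  have h1 := g_phi i j; have h2 := g_phi j i; rewrite (addnC j) in h2.
  case: (ltnP (4 * j) q') => hj; first by rewrite (_ : g j = phi j)// /g hj.
  case: (ltnP (4 * i) q') => hi; first by rewrite (_ : g i = phi i) 1?addrC// /g hi.
  rewrite /g !ifF; try lia.
  by rewrite GD DD; lra.
- move=> i j; rewrite /g; case: ltnP => hi; first by apply: Or31.
  case: ltnP => hj; first by apply: Or32.
  apply: Or33 => x; rewrite ifF; last by lia.
  have h1 := GS (i + j + x)%N; have h2 := DS (i + j + x)%N; rewrite !GD !DD in h1 h2.
  have : phi x.-1 <= G x by apply: le_trans (phiG x); apply: phi_mono; lia.
  by have := D0 x; lra.
- by move=> i j; apply: le_trans (phiD _ _) _; apply: phi_mono; lia.
- move=> s /andP[s1 /existsP[j hj]]; rewrite tsize_nodes in s1.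
  rewrite /g; case: ltnP => hs.
    (* The first leaf plays the part of [w j'], so the divisor of [s] itself has the form treated by
       [key], with a word of [nodes s] letters. *)
    apply: phi_dvd => //; move: hj (tsize_nodes s); rewrite /tsize.
    case: (leaves s) => // i c; rewrite freq_cons => hj [hc]; rewrite -hc.
    by apply: (key c j i); rewrite ?hc//; lra.
  have := D3 _ hs; have : phi (nodes s).-1 <= G (nodes s).
    by apply: le_trans (phiG _); apply: phi_mono; lia.
  lra.
- move=> s u c /andP[_ /existsP[j hj]] /andP[_ /existsP[j' hj']] hf hn hc; rewrite hn.
  case: (ltnP (4 * size c) q') => hcq.
    have dc : (Q %| size c)%N.
      apply: (key c j j') => //.
      have -> : w j' + freq w c - w j = (freq w (leaves s) - w j) - (freq w (leaves u) - w j') by rewrite hf; ring.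
      by have := ler_normB (freq w (leaves s) - w j) (freq w (leaves u) - w j'); lra.
    have := phi_dvd _ hc dc; have := g_phi (nodes u) (size c); lra.
  have gu := g_small (nodes u).
  rewrite [in leRHS](_ : g _ = G (nodes u + size c)%N + D (nodes u + size c)%N - 1); last first.
    by rewrite /g ifF//; lia.
  rewrite GD DD; have := D3 _ hcq; have : phi (size c).-1 <= G (size c).
    by apply: le_trans (phiG _); apply: phi_mono; lia.
  lra.
- apply: (le_trans (g_small _)); rewrite mulrDl /G /D.
  by rewrite le_eqVlt; apply/orP; left; apply/eqP; field; rewrite !gt_eqF.
Qed.

End MultiplesCounting.

(** * Continued fractions *)

Section ContinuedFractions.
Variables (R : realType) (x : R).
Hypotheses (x0 : 0 < x) (xirr : Defs.irrational x).

Lemma cfx_irrational k : Defs.irrational (cfx x k).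
Proof.
rewrite /Defs.irrational; elim: k => // k IH [r hr]; apply: IH; exists (r^-1 + (Num.floor (cfx x k))%:~R).
by rewrite rmorphD/= fmorphV/= -hr /= invrK ratr_int subrK.
Qed.

Lemma cfx_frac k : 0 < cfx x k - cfa x k < 1.
Proof.
rewrite /cfa; have /andP[h1 h2] := floor_itv (cfx x k).
rewrite subr_gt0 lt_neqAle h1 andbT ltrBlDl; apply/andP; split; last by rewrite intrD in h2.
apply/eqP => h; have := @cfx_irrational k; rewrite /Defs.irrational; apply; exists (Num.floor (cfx x k))%:~R.
by rewrite ratr_int.
Qed.

Lemma cfxS k : cfx x k.+1 = (cfx x k - cfa x k)^-1. Proof. by []. Qed.

Lemma cfxS_gt1 k : 1 < cfx x k.+1.
Proof.
rewrite cfxS; have /andP[h1 h2] := cfx_frac k.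
by rewrite invf_gt1.
Qed.

Definition cfn k : nat := `|Num.floor (cfx x k)|%N.

Lemma cfn_cfa k : (cfn k)%:R = cfa x k.
Proof.
rewrite /cfn /cfa -mulrz_nat natz gez0_abs ?floor_ge0//.
by case: k => [|k]; [exact: ltW|apply/ltW/(lt_trans _ (cfxS_gt1 k))].
Qed.

Lemma cfnS_gt0 k : (0 < cfn k.+1)%N.
Proof.
rewrite -(ltr0n R) cfn_cfa /cfa ltr0z floor_gt0; exact/ltW/cfxS_gt1.
Qed.

(** Pairs of consecutive values: the seeds (0, 1) give the denominators q_k of the convergents, the
    seeds (1, a_0) their numerators p_k. *)
Fixpoint cfrec (u v : nat) k : nat * nat :=
  if k is k'.+1 then ((cfrec u v k').2, cfn k * (cfrec u v k').2 + (cfrec u v k').1)%N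
  else (u, v).

Definition cfden k := (cfrec 0 1 k).2.
Definition cfnum k := (cfrec 1 (cfn 0) k).2.
Definition cfden' k := (cfrec 0 1 k).1.
Definition cfnum' k := (cfrec 1 (cfn 0) k).1.

Lemma cfq_cfden k : cfq x k = (cfden k)%:R.
Proof.
rewrite /cfq /cfden; suff -> : cfqp x k = ((cfrec 0 1 k).1%:R, (cfrec 0 1 k).2%:R) by [].
elim: k => // k IH; rewrite [cfqp x k.+1]/= IH /=.
by rewrite natrD natrM cfn_cfa.
Qed.

Lemma cfdenS k : cfden k.+1 = (cfn k.+1 * cfden k + cfden' k)%N. Proof. by []. Qed.
Lemma cfden'S k : cfden' k.+1 = cfden k. Proof. by []. Qed.
Lemma cfnumS k : cfnum k.+1 = (cfn k.+1 * cfnum k + cfnum' k)%N. Proof. by []. Qed.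
Lemma cfnum'S k : cfnum' k.+1 = cfnum k. Proof. by []. Qed.

Lemma cfden_mono k : (cfden k <= cfden k.+1)%N.
Proof. by rewrite cfdenS; have := cfnS_gt0 k; case: (cfn _) => // m _; rewrite mulSn -addnA leq_addr. Qed.

Lemma cfden_gt0 k : (0 < cfden k)%N.
Proof. by elim: k => // k /leq_trans; apply; exact: cfden_mono. Qed.

Lemma cfden_double k : (2 * cfden k <= cfden k.+2)%N.
Proof.
rewrite (cfdenS k.+1) cfden'S; have := cfnS_gt0 k.+1; have := cfden_mono k.
by case: (cfn _) => // m h _; rewrite mulSn; lia.
Qed.

Lemma cf_det k : ((cfnum k)%:Z * (cfden' k)%:Z - (cfnum' k)%:Z * (cfden k)%:Z = (-1) ^+ k.+1).
Proof.
elim: k => [|k IH]; first by rewrite /cfnum /cfden' /cfnum' /cfden/= expr1 mulr0 mulr1 sub0r.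
rewrite cfnumS cfden'S cfnum'S cfdenS exprS -IH !PoszD !PoszM; ring.
Qed.

Lemma cf_eq k : x * (cfx x k.+1 * (cfden k)%:R + (cfden' k)%:R) =
  cfx x k.+1 * (cfnum k)%:R + (cfnum' k)%:R.
Proof.
elim: k => [|k IH].
  rewrite cfxS /cfden /cfden' /cfnum /cfnum'/= cfn_cfa.
  have /andP[h1 _] := cfx_frac 0; rewrite /= in h1 *; field; exact: lt0r_neq0.
rewrite cfdenS cfden'S cfnumS cfnum'S !natrD !natrM cfn_cfa.
have /andP[h1 _] := cfx_frac k.+1.
have h : cfx x k.+1 - cfa x k.+1 != 0 by exact: lt0r_neq0.
rewrite (cfxS k.+1); set X := cfx x k.+1 in IH h *; set A := cfa x k.+1 in h *.
apply: (mulIf h).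
have -> : x * ((X - A)^-1 * (A * (cfden k)%:R + (cfden' k)%:R) + (cfden k)%:R) * (X - A) =
  x * (X * (cfden k)%:R + (cfden' k)%:R) by field.
rewrite IH; by field.
Qed.

(** By [cf_eq] and the determinant identity the error times X q_k + q_(k-1) has modulus 1, where X
    is the complete quotient; as X exceeds its integer part, that factor is at least q_(k+1). *)
Lemma cf_approx k : `|x * (cfden k)%:R - (cfnum k)%:R| <= (cfden k.+1)%:R^-1.
Proof.
set X := cfx x k.+1; set d := X * (cfden k)%:R + (cfden' k)%:R.
have q0 : (0 : R) < (cfden k.+1)%:R by rewrite ltr0n cfden_gt0.
have dq : (cfden k.+1)%:R <= d.
  rewrite cfdenS natrD natrM cfn_cfa lerD2r ler_wpM2r//.
  by have /andP[h _] := cfx_frac k.+1; rewrite -subr_ge0 ltW.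
have d0 : 0 < d by exact: lt_le_trans dq.
have E : (x * (cfden k)%:R - (cfnum k)%:R) * d = - (((-1) ^+ k.+1 : int)%:~R).
  rewrite -cf_det rmorphB !rmorphM /= -!pmulrn.
  have := cf_eq k; rewrite -/X -/d => h.
  have -> : (x * (cfden k)%:R - (cfnum k)%:R) * d = (cfden k)%:R * (x * d) - (cfnum k)%:R * d by ring.
  by rewrite h /d; ring.
have : `|x * (cfden k)%:R - (cfnum k)%:R| * d = 1.
  by rewrite -[X in _ * X](gtr0_norm d0) -normrM E normrN -intr_norm normrX normrN1 expr1n.
move=> h; rewrite -(ler_pM2r d0) h ler_pdivlMl//.
by rewrite mulr1.
Qed.

Lemma cf_coprime k : coprimez (cfnum k)%:Z (cfden k)%:Z.
Proof.
apply/coprimezP; exists ((-1) ^+ k.+1 * (cfden' k)%:Z, - (-1) ^+ k.+1 * (cfnum' k)%:Z) => /=.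
have := cf_det k; move: ((-1) ^+ _) (signrMK k.+1 (1 : int)) => s hs h.
by move: hs; rewrite mulr1 -{2}h => <-; ring.
Qed.

(* A pair approximating the slope well must be proportional to (q_k, p_k): otherwise the
   integer v1 p_k - v2 q_k is nonzero, hence at least 1 in absolute value. *)
Lemma cf_multiple k (v1 v2 : int) : 2 * `|v1%:~R : R| <= (cfden k.+1)%:R ->
  `|v2%:~R - x * v1%:~R| < (2 * (cfden k)%:R)^-1 ->
  exists a : int, v1 = a * (cfden k)%:Z /\ v2 = a * (cfnum k)%:Z.
Proof.
move=> h1 h2; set q := cfden k in h2 *; set p := cfnum k.
have q0 : (0 : R) < q%:R by rewrite ltr0n cfden_gt0.
have E : v1 * p%:Z = v2 * q%:Z.
  apply/eqP; rewrite -subr_eq0; apply: contraT => ne.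
  have : 1 <= `|(v1 * p%:Z - v2 * q%:Z)%:~R : R|.
    by rewrite -intr_norm (ler_int R 1) -gtz0_ge1 normr_gt0.
  have -> : (v1 * p%:Z - v2 * q%:Z)%:~R = - (v1%:~R * (x * q%:R - p%:R)) - q%:R * (v2%:~R - x * v1%:~R) :> R.
    by rewrite rmorphB !rmorphM /= -!pmulrn; ring.
  move=> h; have := ler_normB (- (v1%:~R * (x * q%:R - p%:R))) (q%:R * (v2%:~R - x * v1%:~R)).
  rewrite normrN !normrM (gtr0_norm q0) => hh.
  have a1 : `|v1%:~R| * `|x * q%:R - p%:R| <= 2^-1 :> R.
    have Q0 : (0 : R) < (cfden k.+1)%:R by rewrite ltr0n cfden_gt0.
    apply: (le_trans (ler_wpM2l (normr_ge0 _) (cf_approx k))).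
    by rewrite ler_pdivrMr//; lra.
  have a2 : q%:R * `|v2%:~R - x * v1%:~R| < 2^-1 :> R.
    rewrite -ltr_pdivlMl//; apply: (lt_le_trans h2).
    by rewrite invfM mulrC.
  by exfalso; lra.
have : (q%:Z %| v1)%Z.
  have : (q%:Z %| v1 * p%:Z)%Z by rewrite E dvdz_mull.
  by rewrite Gauss_dvdzl// coprimez_sym cf_coprime.
move=> /dvdzP[a ha]; exists a; split => //.
have qz : q%:Z != 0 by rewrite eqz_nat -lt0n cfden_gt0.
by apply: (mulIf qz); rewrite -E ha; ring.
Qed.

(** Absorbs the surplus 12/q' of the finer count. With q = b^2 one has ln q / q <= 2/b, and b grows
    by sqrt 2 > 4/3 every two steps, so the 1/b sum to at most 4 (1 + 1); hence 16. *)
Lemma cf_log_sum K : \sum_(m < K) ln (cfq x m.+1) / cfq x m.+1 <= 16.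
Proof.
pose b m := Num.sqrt (cfq x m).
have b1 m : 1 <= b m.
  by rewrite /b -sqrtr1 ler_wsqrtr// cfq_cfden ler1n cfden_gt0.
have b0 m : 0 < b m by apply: lt_le_trans (b1 m).
have bE m : cfq x m = b m ^+ 2.
  by rewrite /b sqr_sqrtr// cfq_cfden.
have b2 m : (b m.+2)^-1 <= 3 / 4 * (b m)^-1.
  have h : 4 / 3 * b m <= b m.+2.
    have b3 : 0 <= 4 / 3 * b m by rewrite mulr_ge0// ltW.
    rewrite -(@ler_pXn2r _ 2)// ?nnegrE//; last exact: (ltW (b0 _)).
    rewrite exprMn -!bE !cfq_cfden.
    have : 2 * (cfden m)%:R <= (cfden m.+2)%:R :> R by rewrite -natrM ler_nat cfden_double.
    have : (0 : R) <= (cfden m)%:R by [].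
    have -> : (4 / 3) ^+ 2 = 16 / 9 :> R by field.
    move: (cfden m)%:R (cfden m.+2)%:R => u v hu huv; lra.
  have -> : 3 / 4 * (b m)^-1 = (4 / 3 * b m)^-1 by field; rewrite gt_eqF.
  by rewrite lef_pV2// ?posrE// mulr_gt0.
have hln m : ln (cfq x m) / cfq x m <= 2 * (b m)^-1.
  have h := ltW (ln_sublinear (b0 m)).
  rewrite bE lnXn// ler_pdivrMr ?exprn_gt0//.
  by rewrite (_ : 2 / b m * b m ^+ 2 = b m *+ 2) ?lerMn2r//; field; rewrite gt_eqF.
(* The term with the factor 4 is a potential: [b2] bounds 4/b_(k+3) by 3/b_(k+1), which frees
   1/b_(k+1) for the sum. *)
have tele k : \sum_(m < k) (b m.+1)^-1 + 4 * ((b k.+1)^-1 + (b k.+2)^-1) <= 8.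
  elim: k => [|k IH].
    rewrite big_ord0 add0r.
    have i1 m : (b m)^-1 <= 1 by rewrite invf_le1.
    by have := i1 1%N; have := i1 2%N; lra.
  rewrite big_ord_recr /=; have := b2 k.+1; lra.
apply: (@le_trans _ _ (\sum_(m < K) 2 * (b m.+1)^-1)).
  by apply: ler_sum => m _; exact: hln.
rewrite -mulr_sumr; have := tele K.
have : 0 < (b K.+1)^-1 by rewrite invr_gt0.
have : 0 < (b K.+2)^-1 by rewrite invr_gt0.
lra.
Qed.

End ContinuedFractions.

(** * The one-dimensional Bruno condition *)

Section BrunoOneDim.
Variables (R : realType) (w : 'I_2 -> R) (i0 i1 : 'I_2).
Hypotheses (hi0 : (i0 : nat) = 0%N) (hi1 : (i1 : nat) = 1%N).
Hypotheses (w10 : w i1 <> 0) (x0 : 0 < - w i0 / w i1) (xirr : Defs.irrational (- w i0 / w i1)).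
Local Notation x := (- w i0 / w i1).
Local Notation q := (cfden x).
Local Notation p := (cfnum x).

Lemma ord2_sum (j : 'I_2) : ((j == i0)%:Z + (j == i1)%:Z = 1 :> int) /\
  w j = w i1 * (((j == i1)%:Z)%:~R - x * ((j == i0)%:Z)%:~R).
Proof.
have w1 : w i1 != 0 by apply/eqP.
have ne : i0 != i1 by apply/eqP => /(congr1 val) /=; rewrite hi0 hi1.
have [/eqP->|/eqP->] : j == i0 \/ j == i1.
- by case: j => -[|[|//]] hj; [left|right]; apply/eqP/val_inj; rewrite /= ?hi0 ?hi1.
- rewrite eqxx (negbTE ne); split => //=.
  by rewrite mulr1 sub0r mulrN mulrC divfK// opprK.
- by rewrite eqxx eq_sym (negbTE ne); split => //=; rewrite mulr0 subr0 mulr1.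
Qed.

Lemma freq_pair (c : seq 'I_2) :
  exists v1 v2 : nat, (v1 + v2 = size c)%N /\ freq w c = w i1 * (v2%:R - x * v1%:R).
Proof.
elim: c => [|j c [v1 [v2 [hs hf]]]].
  by exists 0%N, 0%N; rewrite /freq big_nil mulr0 subrr mulr0.
have [h1 h2] := ord2_sum j.
exists ((j == i0) + v1)%N, ((j == i1) + v2)%N; split.
  by move: h1 => /=; rewrite -hs; case: (j == i0); case: (j == i1) => //= _; lia.
by rewrite freq_cons hf h2 !natrD -!pmulrn; ring.
Qed.

(** Adding the letter [j'] and removing [j] leaves letter counts V1, V2 of sum [size c] with V2 - x
    V1 small. Hence (V1, V2) = a (q_k, p_k), and [size c] is a (q_k + p_k). *)
Lemma small_pair_dvdn k (dlt : R) (c : seq 'I_2) j j' :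
  2 * dlt <= `|w i1| / (2 * (q k)%:R) ->
  (0 < size c)%N -> (4 * size c < q k.+1)%N ->
  `|w j' + freq w c - w j| < 2 * dlt -> (q k + p k %| size c)%N.
Proof.
move=> hd c0 hc hs.
have [v1 [v2 [hv hf]]] := freq_pair c.
have [a1 a2] := ord2_sum j; have [b1 b2] := ord2_sum j'.
pose V1 : int := (j' == i0)%:Z + v1%:Z - (j == i0)%:Z.
pose V2 : int := (j' == i1)%:Z + v2%:Z - (j == i1)%:Z.
have Vs : V1 + V2 = size c by rewrite -hv PoszD /V1 /V2; lia.
have Vf : w j' + freq w c - w j = w i1 * (V2%:~R - x * V1%:~R).
  by rewrite a2 b2 hf /V1 /V2 !rmorphB !rmorphD /= -!pmulrn; ring.
have w1 : 0 < `|w i1| by rewrite normr_gt0; apply/eqP.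
have [||a [ha1 ha2]] := @cf_multiple R x x0 xirr k V1 V2.
- have h : `|V1| <= (size c).+1%:Z.
    by rewrite /V1 -hv; move: (j' == i0) (j == i0) => [] []; lia.
  have : `|V1%:~R : R| <= (size c).+1%:R by rewrite -intr_norm pmulrn ler_int.
  have : (2 * (size c).+1%:R <= (q k.+1)%:R :> R) by rewrite -natrM ler_nat; lia.
  by lra.
- rewrite -(ltr_pM2l w1) -normrM -Vf; exact: lt_le_trans hs hd.
apply/dvdnP; exists `|a|%N.
have h : (size c)%:Z = a * (q k + p k)%N%:Z by rewrite -Vs ha1 ha2 PoszD; ring.
by rewrite -[LHS](absz_nat (size c)) h abszM absz_nat.
Qed.

Lemma Bruno1_divisor_bound_pair (s : R) : nonresonant w -> 0 < s -> Bruno1 (w i0) (w i1) s ->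
  divisor_bound w s.
Proof.
move=> nr s0 [_ [_ [_ [M [N0 hB]]]]].
apply: divisor_bound_of_levels => //.
pose m1 := Num.min 1 `|w i1|.
have m10 : 0 < m1 by rewrite lt_min ltr01 normr_gt0; apply/eqP.
have m1w : m1 <= `|w i1| by rewrite ge_min lexx orbT.
have m11 : m1 <= 1 by rewrite ge_min lexx.
have q0 k : (0 : R) < (q k)%:R by rewrite ltr0n cfden_gt0.
have q1 k : (1 : R) <= (q k)%:R by rewrite ler1n cfden_gt0.
(* Small enough for the hypothesis of [small_pair_dvdn]; [m1 <= 1] keeps the thresholds at most
   1. *)
pose d k := m1 / (4 * (q k)%:R).
have d0 k : 0 < d k by rewrite divr_gt0// mulr_gt0.
have d2 k : 2 * d k <= `|w i1| / (2 * (q k)%:R).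
  have -> : 2 * d k = m1 / (2 * (q k)%:R) by rewrite /d; move: (lt0r_neq0 (q0 k)) => ?; field.
  by rewrite ler_wpM2r// invr_ge0 mulr_ge0.
have dmono k : d k.+1 <= d k.
  rewrite /d; apply: ler_wpM2l; first exact: ltW.
  by rewrite lef_pV2 ?posrE ?mulr_gt0// ler_wpM2l// ler_nat cfden_mono.
(* Any growth of q_k will do: it bounds the indices k with q_k <= 4 N, so that a largest one
   exists. *)
have kmono k : (k <= q k.*2)%N.
  elim: k => // k IH; rewrite doubleS.
  have := cfden_double x0 xirr k.*2; have := cfden_gt0 x0 xirr k.*2; lia.
have kmono2 k : (k <= (q k).*2.+1)%N.
  have [m [->|->]] : exists m, k = m.*2 \/ k = m.*2.+1.
    exists k./2; rewrite -{1 3}(odd_double_half k); case: (odd k); [right|left].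
      by rewrite add1n.
    by rewrite add0n.
  - by have := kmono m; lia.
  - by have := kmono m; have := cfden_mono x0 xirr m.*2; lia.
exists (- ln (d 0%N) + (M + s * ln 4 + 12 * 16)), N0 => N hN N1.
(* 4 N rather than N, to match [4 * size c < q k.+1] in [small_pair_dvdn]; in the Bruno sum this
   costs only s ln 4. *)
have [k hk] : exists k, (q k <= 4 * N < q k.+1)%N.
  have ex : exists k, (q k <= 4 * N)%N by exists 0%N; rewrite /cfden /=; lia.
  have ub k : (q k <= 4 * N)%N -> (k <= (4 * N).*2.+1)%N.
    by move=> h; apply: (leq_trans (kmono2 k)); lia.
  case: (ex_maxnP ex ub) => k hk hmax; exists k; rewrite hk /= ltnNge; apply/negP => /hmax.
  by rewrite ltnn.
have /andP[hk1 hk2] := hk.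
exists k.+1, d, (fun m => 1 / (q m)%:R + 12 / (q m.+1)%:R); split.
- move=> m; rewrite d0 /= /d ler_pdivrMr ?mulr_gt0// mul1r; have := q1 m; lra.
- exact: dmono.
(* No divisor of degree at most N lies below the last threshold: it would force q_(k+1) + p_(k+1) <=
   size c < N, against q_(k+1) > 4 N. *)
- move=> [//|i c] j /=; rewrite ltnS => /andP[c0 cN]; rewrite leNgt; apply/negP => h.
  have := @small_pair_dvdn k.+1 (d k.+1) c j i (d2 _) c0 _ _.
  rewrite -freq_cons => hdv.
  have {}hdv : (q k.+1 + p k.+1 %| size c)%N.
    apply: hdv; last by apply: (lt_trans h); have := d0 k.+1; lra.
    by have := cfden_mono x0 xirr k.+1; lia.
  by have := dvdn_leq c0 hdv; lia.
- move=> t m mk tN.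
  have Q0 : (0 < q m + p m)%N by rewrite addn_gt0 cfden_gt0.
  apply: le_trans (@count_small_multiples R 2 w (q m + p m) (q m.+1) (d m) t Q0 (cfden_gt0 x0 xirr _) (d0 m) _) _.
    by move=> c j j' c0 hc hs; apply: (@small_pair_dvdn m (d m) c j j' (d2 m)).
  have h : (q m)%:R <= (q m + p m)%N%:R :> R by rewrite ler_nat leq_addr.
  apply: ler_wpM2r => //; rewrite lerD2r !mul1r lef_pV2// posrE//.
  by rewrite ltr0n.
- rewrite -addrA lerD2l.
  have hsum := hB (4 * N)%N k _ _.
  rewrite !cfq_cfden// in hsum.
  have {}hsum := hsum ltac:(lia) ltac:(by rewrite ler_nat ltr_nat).
  have hl := cf_log_sum x0 xirr k.+1.
  have N4 : ln (4 * N)%:R = ln 4 + ln N%:R :> R by rewrite natrM lnM ?posrE ?ltr0n.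
  rewrite N4 in hsum.
  apply: (@le_trans _ _ (\sum_(m < k.+1) (ln (cfq x m.+1) / cfq x m + 12 * (ln (cfq x m.+1) / cfq x m.+1)))).
    apply: ler_sum => m _; rewrite !cfq_cfden//.
    have ld i : ln (d i) = ln m1 - ln 4 - ln (q i)%:R.
      rewrite /d lnM ?posrE ?invr_gt0 ?mulr_gt0// lnV ?posrE ?mulr_gt0// lnM ?posrE//.
      by ring.
    have -> : ln (d m) - ln (d m.+1) = ln (q m.+1)%:R - ln (q m)%:R by rewrite !ld; ring.
    have l0 : 0 <= ln (q m)%:R :> R by rewrite ln_ge0.
    have k0 : 0 <= 1 / (q m)%:R + 12 / (q m.+1)%:R :> R by rewrite addr_ge0// divr_ge0.
    apply: (@le_trans _ _ ((1 / (q m)%:R + 12 / (q m.+1)%:R) * ln (q m.+1)%:R)).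
      by rewrite ler_wpM2l// gerBl.
    by rewrite le_eqVlt; apply/orP; left; apply/eqP; ring.
  rewrite big_split/= -mulr_sumr; lra.
Qed.

End BrunoOneDim.

Lemma Bruno1_divisor_bound (R : realType) (n : nat) (w : 'I_n -> R) (s : R) :
  nonresonant w -> 0 < s -> n = 2%N -> Bruno1_at w s -> divisor_bound w s.
Proof.
move=> nr s0 n2; move: w nr; rewrite n2 => w nr [i0 [i1 [h0 [h1 hB]]]].
have [w10 [x0 [xirr _]]] := hB.
exact: (Bruno1_divisor_bound_pair h0 h1).
Qed.

(** * Truncated normal form *)

Section PowerSeries.
Variables (R : realType) (n : nat).
Local Notation word := (seq 'I_n).
Implicit Types (z h : vec R n) (X : R) (b : 'I_n -> nat).

Definition word_of b : word := flatten [seq nseq (b j) j | j <- enum 'I_n].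

Lemma prod_word_of h b : \prod_(i <- word_of b) h i = mono h b.
Proof.
rewrite /word_of big_flatten big_map big_enum; apply: eq_bigr => j _.
by rewrite big_nseq iter_mulr_1.
Qed.

Lemma size_word_of b : size (word_of b) = (\sum_(j < n) b j)%N.
Proof.
rewrite /word_of size_flatten sumnE /shape -map_comp big_map big_enum/=.
by apply: eq_bigr => j _; rewrite size_nseq.
Qed.

Definition homw (c : ('I_n -> nat) -> R[i]) k : seq (R[i] * word) :=
  [seq (c (fun j => b j : nat), word_of (fun j => b j : nat)) |
     b : {ffun 'I_n -> 'I_k.+1} <- enum [pred b : {ffun 'I_n -> 'I_k.+1} | (\sum_(j < n) (b j : nat))%N == k]].

Lemma homw_size c k e : e \in homw c k -> size e.2 = k.
Proof.
move=> /mapP[b]; rewrite mem_enum inE => /eqP hb ->.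
by rewrite size_word_of.
Qed.

Lemma wev_homw c h k : wev (homw c k) h = hom_term c h k.
Proof.
rewrite /wev big_map big_enum /hom_term; apply: eq_big => b; first by rewrite inE.
by rewrite prod_word_of.
Qed.

Lemma wnorm_homw c X k : 0 <= X -> wnorm X (homw c k) = hom_abs c (fun=> X%:C%C) k.
Proof.
move=> X0; rewrite /wnorm big_map big_enum /hom_abs; apply: eq_big => b; first by rewrite inE.
move=> _; congr (_ * _); rewrite -prod_word_of cabs_prod.
rewrite (eq_bigr (fun=> X)) => [|i _]; last by rewrite cabs_real ger0_norm.
by rewrite big_const_seq count_predT iter_mulr_1.
Qed.

Definition wseries (c : ('I_n -> nat) -> R[i]) (a b : nat) : seq (R[i] * word) := flatten [seq homw c k | k <- index_iota a b].

Lemma wev_wseries c (a b : nat) h : wev (wseries c a b) h = \sum_(a <= k < b) hom_term c h k.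
Proof.
rewrite /wev /wseries big_flatten big_map; apply: eq_bigr => k _.
by rewrite -wev_homw.
Qed.

Lemma wnorm_wseries c (a b : nat) X : 0 <= X ->
  wnorm X (wseries c a b) = \sum_(a <= k < b) hom_abs c (fun=> X%:C%C) k.
Proof.
move=> X0; rewrite /wnorm /wseries big_flatten big_map; apply: eq_bigr => k _.
by rewrite -wnorm_homw.
Qed.

Lemma wseries_size c (a b : nat) e : e \in wseries c a b -> (a <= size e.2 < b)%N.
Proof.
move=> /flattenP[s /mapP[k]]; rewrite mem_index_iota => hk -> /homw_size ->.
exact: hk.
Qed.

Lemma hom_abs_ge0 c h k : 0 <= hom_abs c h k.
Proof. by apply: sumr_ge0 => b _; rewrite mulr_ge0 ?cabs_ge0. Qed.

Lemma hom_term_scale c h (l : R) k :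
  hom_term c (fun j => l%:C%C * h j) k = (l ^+ k)%:C%C * hom_term c h k.
Proof.
rewrite -!wev_homw /wev big_seq [in RHS]big_seq mulr_sumr; apply: eq_bigr => e /homw_size <-.
rewrite mulrCA; congr (_ * _); elim: (e.2) => [|i s IH]; first by rewrite !big_nil mul1r.
by rewrite !big_cons IH /= exprS rmorphM/=; ring.
Qed.

Lemma cvg_dist_le (u : nat -> R) (l a B : R) N : u @ \oo --> l ->
  (forall K, (N <= K)%N -> `|u K - a| <= B) -> `|l - a| <= B.
Proof.
move=> ul hu; rewrite leNgt; apply/negP => h.
have e0 : 0 < `|l - a| - B by rewrite subr_gt0.
have /cvgrPdist_lt/(_ _ e0)[K _ hK] := ul.
have h1 := hK (maxn K N) (leq_maxl _ _); have h2 := hu (maxn K N) (leq_maxr _ _).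
by have := ler_distD (u (maxn K N)) l a; simpl in h1; lra.
Qed.

Lemma exp2_gt (x : R) : exists k : nat, x < 2 ^+ k.
Proof.
exists (Num.truncn x).+1; apply: (lt_le_trans (truncnS_gt _)).
by rewrite -natrX ler_nat ltnW// ltn_expl.
Qed.

(** [g N] collects degrees 2 to N of the expansion of [F] at 0, whose degrees 0 and 1 turn out to be
    those of Az. Absolute convergence at the point (rho, ..., rho) provides the majorant [M]. *)
Lemma analytic_words (w : 'I_n -> R) (F f : vec R n -> vec R n) :
  analytic_on F (@inD1 R n) ->
  (forall z, inD1 z -> F z = (fun j => (0 +i* w j)%C * z j + f z j)) ->
  f (@vzero R n) = @vzero R n -> Dzero f ->
  exists (rho M : R) (g : nat -> 'I_n -> seq (R[i] * word)),
    [/\ 0 < rho <= 2^-1, 1 <= M,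
      (forall N j e, e \in g N j -> (1 < size e.2 <= N)%N),
      (forall N j, wnorm rho (g N j) <= M) &
      (forall N j z th, (0 < N)%N -> 0 <= th <= 1 -> vnorm z <= th * rho ->
         cabs (f z j - wev (g N j) z) <= 2 * (th ^+ N.+1 * M))].
Proof.
move=> hF hFf f0 Df.
have [|rho1 [rho10 [c hc]]] := hF (@vzero R n).
  by move=> j; rewrite /vzero cabs0.
have vs0 z : vsub z (@vzero R n) = z by apply/funext => j; rewrite /vsub subr0.
pose rho := Num.min rho1 1 / 2.
have rho0 : 0 < rho by rewrite divr_gt0// lt_min rho10 ltr01.
have rho2 : rho <= 2^-1 by rewrite /rho ler_pdivrMr// mulVf// ge_min lexx orbT.
have rho1' : rho < rho1.
  by have : Num.min rho1 1 <= rho1 by [rewrite ge_min lexx]; rewrite /rho; lra.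
have inD z : vnorm z <= rho -> inD1 z.
  by move=> hz j; apply: (le_lt_trans (cabs_le_vnorm z j)); lra.
have hcz z : vnorm z <= rho -> forall j, [/\
    cvgn (fun K => \sum_(k < K) hom_abs (c j) z k),
    (fun K => complex.Re (\sum_(k < K) hom_term (c j) z k)) @ \oo --> complex.Re (F z j) &
    (fun K => complex.Im (\sum_(k < K) hom_term (c j) z k)) @ \oo --> complex.Im (F z j)].
  move=> hz j; have [||h1 [h2 h3]] := hc z _ _ j; first exact: inD.
    by rewrite vs0; apply: le_lt_trans rho1'.
  by rewrite vs0 in h1 h2 h3; split.
pose zr : vec R n := fun=> rho%:C%C.
have zr_rho : vnorm zr <= rho.
  by apply: vnorm_le => [|j]; [exact: ltW|rewrite cabs_real gtr0_norm].
pose Mj j : R := limn (fun K => \sum_(k < K) hom_abs (c j) zr k).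
have hMj K j : \sum_(k < K) hom_abs (c j) zr k <= Mj j.
  apply: (@nondecreasing_cvgn_le _ (fun K => \sum_(k < K) hom_abs (c j) zr k)).
    apply/nondecreasing_seqP => k; rewrite big_ord_recr/= lerDl; exact: hom_abs_ge0.
  by have [] := hcz _ zr_rho j.
pose M : R := 1 + \sum_j `|Mj j|.
have MjM j : Mj j <= M.
  rewrite /M (bigD1 j)//=; have : 0 <= \sum_(i < n | i != j) `|Mj i| by apply: sumr_ge0.
  by have := ler_norm (Mj j); lra.
have M1 : 1 <= M by rewrite /M lerDl sumr_ge0.
have hM (a b : nat) j : wnorm rho (wseries (c j) a b) <= M.
  rewrite wnorm_wseries ?(ltW rho0)//; apply: le_trans (MjM j); apply: le_trans (hMj b j).
  rewrite -(big_mkord xpredT (fun k => hom_abs (c j) zr k)).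
  case: (leqP a b) => ab; last first.
    by rewrite [leLHS]big_geq ?(ltnW ab)//; apply: sumr_ge0 => k _; exact: hom_abs_ge0.
  rewrite (@big_cat_nat _ _ _ a 0 b)//= lerDr; apply: sumr_ge0 => k _; exact: hom_abs_ge0.
have tail N j z th : 0 <= th <= 1 -> vnorm z <= th * rho ->
    cabs (F z j - wev (wseries (c j) 0 N) z) <= 2 * (th ^+ N * M).
  move=> t01 hz; have /andP[t0 t1] := t01.
  have hzr : vnorm z <= rho by apply: (le_trans hz); rewrite ler_piMl// ltW.
  have [_ hRe hIm] := hcz z hzr j.
  have hK K : (N <= K)%N ->
      cabs (\sum_(k < K) hom_term (c j) z k - wev (wseries (c j) 0 N) z) <= th ^+ N * M.
    move=> NK; rewrite wev_wseries -(big_mkord xpredT (fun k => hom_term (c j) z k)).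
    rewrite (@big_cat_nat _ _ _ N 0 K)//= addrAC subrr add0r -wev_wseries.
    apply: le_trans (ler_wpM2l (exprn_ge0 _ t0) (hM N K j)).
    by apply: wev_bound => //; [exact: ltW|move=> e /wseries_size/andP[]].
  apply: cabs_le2; rewrite ?ReB ?ImB.
  - apply: (cvg_dist_le (N := N) hRe) => K NK; rewrite -ReB.
    exact: le_trans (Re_le_cabs _) (hK K NK).
  - apply: (cvg_dist_le (N := N) hIm) => K NK; rewrite -ImB.
    exact: le_trans (Im_le_cabs _) (hK K NK).
have S2 j z : wev (wseries (c j) 0 2) z = hom_term (c j) z 0 + hom_term (c j) z 1.
  by rewrite wev_wseries big_nat_recr//= big_nat1.
have hom0E j z z' : hom_term (c j) z 0 = hom_term (c j) z' 0.
  rewrite -!wev_homw /wev big_seq [in RHS]big_seq; apply: eq_bigr => e /homw_size/size0nil ->.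
  by rewrite !big_nil.
have v0 : vnorm (@vzero R n) = 0.
  by apply/eqP; rewrite eq_le vnorm_ge0 andbT; apply: vnorm_le => // j; rewrite cabs0.
(* At the origin [tail] can be taken with ratio 0, so its error vanishes. *)
have hom0 j z : hom_term (c j) z 0 = 0.
  have h := tail 2%N j (@vzero R n) 0.
  rewrite lexx ler01 v0 mul0r lexx expr0n/= mul0r mulr0 in h; have {}h := h isT isT.
  have z1 : hom_term (c j) (@vzero R n) 1 = 0.
    have := @hom_term_scale (c j) (@vzero R n) 0 1; rewrite expr1 mul0r => <-.
    by congr hom_term; apply/funext => i; rewrite mul0r.
  move: h; rewrite S2 z1 addr0 hFf ?f0; last by apply: inD; rewrite v0 ltW.
  rewrite /vzero mulr0 addr0 sub0r cabsN => h; rewrite (hom0E _ _ (@vzero R n)).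
  by apply/eqP; rewrite -cabs_eq0 eq_le h cabs_ge0.
(* Along l z with l tending to 0 the discrepancy [a] of the linear parts scales like l, whereas [f]
   contributes at most eps l |z| and the tail 2 M l^2; the choice of [eps] then gives a <= a/2. *)
have hom1 j z : vnorm z <= rho -> hom_term (c j) z 1 = (0 +i* w j)%C * z j.
  move=> hz; apply/eqP; rewrite -subr_eq0 -cabs_eq0 eq_le cabs_ge0 andbT.
  set a := cabs _.
  pose eps := a / (2 * (vnorm z + 1)).
  have z1 : 0 < vnorm z + 1 by rewrite ltr_wpDl// vnorm_ge0.
  rewrite leNgt; apply/negP => a0.
  have eps0 : 0 < eps by rewrite divr_gt0// mulr_gt0.
  have [del [del0 hdel]] := Df eps eps0.
  have [k0 hk0] := exp2_gt (rho / del).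
  rewrite ltr_pdivrMr// in hk0.
  have key : a <= eps * vnorm z.
    apply: (@le_geometric_le _ _ _ (2 * M)) => k.
    pose l : R := (2 ^+ (k + k0))^-1.
    have l0 : 0 < l by rewrite invr_gt0 exprn_gt0.
    have l1 : l <= 1 by rewrite invf_le1 ?exprn_gt0// exprn_ege1// ler1n.
    pose lz : vec R n := fun i => l%:C%C * z i.
    have lzn : vnorm lz <= l * vnorm z.
      apply: vnorm_le => [|i]; first by rewrite mulr_ge0 ?vnorm_ge0// ltW.
      by rewrite cabsM cabs_real gtr0_norm// ler_wpM2l ?cabs_le_vnorm// ltW.
    have lzr : vnorm lz <= l * rho by apply: (le_trans lzn); rewrite ler_wpM2l// ltW.
    have lzd : vnorm lz < del.
      apply: (le_lt_trans lzr); rewrite /l exprD invfM.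
      apply: (@le_lt_trans _ _ ((2 ^+ k0)^-1 * rho)).
        rewrite ler_wpM2r ?(ltW rho0)// ler_piMl ?invr_ge0 ?exprn_ge0//.
        by rewrite invf_le1 ?exprn_gt0// exprn_ege1// ler1n.
      by rewrite ltr_pdivrMl ?exprn_gt0// mulrC.
    have lzD : inD1 lz by apply: inD; apply: (le_trans lzr); rewrite ler_piMl// ltW.
    have h1 := tail 2%N j lz l _ lzr; rewrite (ltW l0) l1 in h1.
    have {}h1 := h1 isT.
    rewrite S2 hom0 add0r hom_term_scale expr1 hFf// in h1.
    have h2 := le_trans (cabs_le_vnorm (f lz) j) (hdel lz lzd).
    have h3 : l * a <= l * (eps * vnorm z + 2 * M * l).
      have -> : l * a = cabs ((0 +i* w j)%C * lz j - l%:C%C * hom_term (c j) z 1).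
        rewrite /lz mulrCA -mulrBr cabsM cabs_real gtr0_norm// /a.
        by rewrite cabsC.
      have -> : (0 +i* w j)%C * lz j - l%:C%C * hom_term (c j) z 1 =
         ((0 +i* w j)%C * lz j + f lz j - l%:C%C * hom_term (c j) z 1) - f lz j by ring.
      apply: (le_trans (cabsB _ _)); apply: (le_trans (lerD h1 h2)).
      have h4 := ler_wpM2l (ltW eps0) lzn.
      by rewrite expr2; lra.
    rewrite ler_pM2l// in h3; apply: (le_trans h3); rewrite lerD2l ler_wpM2l ?mulr_ge0//; first lra.
    by rewrite /l lef_pV2 ?posrE ?exprn_gt0// ler_eXn2l// ?ltr1n// leq_addr.
  have : eps * vnorm z <= a / 2.
    have -> : a / 2 = eps * (vnorm z + 1) by rewrite /eps; field; exact: lt0r_neq0.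
    by rewrite ler_wpM2l ?(ltW eps0)// lerDl.
  by lra.
exists rho, M, (fun N j => wseries (c j) 2 N.+1); split => //.
- by rewrite rho0.
- by move=> N j e /wseries_size; rewrite ltnS.
- move=> N j z th N0 t01 hz; have /andP[t0 t1] := t01.
  have hzr : vnorm z <= rho by apply: (le_trans hz); rewrite ler_piMl// ltW.
  have := tail N.+1 j z th t01 hz.
  rewrite (hFf _ (inD _ hzr)).
  have -> : wev (wseries (c j) 0 N.+1) z = (0 +i* w j)%C * z j + wev (wseries (c j) 2 N.+1) z.
    rewrite -hom1// -[hom_term _ _ 1]add0r -(hom0 j z) -S2 !wev_wseries.
    by rewrite (@big_cat_nat _ _ _ 2 0 N.+1)//=.
  by rewrite opprD addrACA subrr add0r.
Qed.

End PowerSeries.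

(** * Homological equation and the polynomial change of variables *)

Section NormalForm.
Variables (R : realType) (n : nat) (w : 'I_n -> R).
Local Notation word := (seq 'I_n).
Implicit Types (z : vec R n) (t : R).

Definition cis t : R[i] := (cos t +i* sin t)%C.

Lemma cabs_cis t : cabs (cis t) = 1.
Proof. by rewrite cabs_def /= cos2Dsin2 sqrtr1. Qed.

Lemma cis0 : cis 0 = 1.
Proof. by rewrite /cis cos0 sin0. Qed.

Lemma cisD a b : cis (a + b) = cis a * cis b.
Proof.
rewrite /cis cosD sinD; apply/eqP; rewrite eq_complex /= eqxx/=.
by apply/eqP; ring.
Qed.

Definition flow t z : vec R n := fun j => cis (w j * t) * z j.

Lemma flow0 z : flow 0 z = z.
Proof. by apply/funext => j; rewrite /flow mulr0 cis0 mul1r. Qed.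

Lemma vnorm_flow t z : vnorm (flow t z) = vnorm z.
Proof. by apply: eq_bigr => j _; rewrite /flow cabsM cabs_cis mul1r. Qed.

Lemma prod_flow t z (s : word) :
  \prod_(i <- s) flow t z i = cis (freq w s * t) * \prod_(i <- s) z i.
Proof.
elim: s => [|i s IH]; first by rewrite /freq !big_nil mul0r cis0 mul1r.
by rewrite !big_cons IH /flow freq_cons mulrDl cisD; ring.
Qed.

Lemma is_derive_cis (a : R[i]) (x t : R) :
  is_derive t (1 : R) (fun s => complex.Re (a * cis (x * s))) (complex.Re ((0 +i* x)%C * a * cis (x * t))) /\
  is_derive t (1 : R) (fun s => complex.Im (a * cis (x * s))) (complex.Im ((0 +i* x)%C * a * cis (x * t))).
Proof.
have h1 : is_derive t (1 : R) ( *%R x) x.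
  by have := @is_deriveZ R R R id x t 1 1 (is_derive_id _ _); rewrite /GRing.scale/= mulr1.
have hc : is_derive t (1 : R) (fun s => cos (x * s)) (- sin (x * t) * x).
  exact: (@is_derive1_comp R cos ( *%R x) t _ _ (is_derive_cos _) h1).
have hs : is_derive t (1 : R) (fun s => sin (x * s)) (cos (x * t) * x).
  exact: (@is_derive1_comp R sin ( *%R x) t _ _ (is_derive_sin _) h1).
case: a => u v; split.
- have := is_deriveB (is_deriveZ u hc) (is_deriveZ v hs).
  rewrite /GRing.scale/= (_ : u * _ - _ = complex.Re ((0 +i* x)%C * (u +i* v)%C * cis (x * t))) //=.
  by ring.
- have := is_deriveD (is_deriveZ u hs) (is_deriveZ v hc).
  rewrite /GRing.scale/= (_ : u * _ + _ = complex.Im ((0 +i* x)%C * (u +i* v)%C * cis (x * t))) //=.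
  by ring.
Qed.

Lemma is_derive_sum_seq (I : Type) (s : seq I) (F : I -> R -> R) (dF : I -> R) t :
  (forall i, is_derive t (1 : R) (F i) (dF i)) ->
  is_derive t (1 : R) (fun x => \sum_(i <- s) F i x) (\sum_(i <- s) dF i).
Proof.
move=> h; elim: s => [|i s IH].
  rewrite big_nil (_ : (fun x => _) = cst 0); first exact: is_derive_cst.
  by apply/funext => x; rewrite big_nil.
rewrite big_cons (_ : (fun x => _) = F i + (fun x => \sum_(i <- s) F i x)); first exact: is_deriveD.
by apply/funext => x; rewrite big_cons.
Qed.

(** Lie derivative along the linear flow, for which every monomial is an eigenvector. *)
Definition wderiv (p : seq (R[i] * word)) : seq (R[i] * word) :=
  [seq ((0 +i* freq w c.2)%C * c.1, c.2) | c <- p].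

Lemma deriv_curve_flow (p : 'I_n -> seq (R[i] * word)) z t :
  deriv_curve (fun s j => wev (p j) (flow s z)) t (fun j => wev (wderiv (p j)) (flow t z)).
Proof.
move=> j.
have E c s : c.1 * \prod_(i <- c.2) flow s z i = (c.1 * \prod_(i <- c.2) z i) * cis (freq w c.2 * s).
  by rewrite prod_flow; ring.
rewrite /wev /wderiv big_map; split.
- rewrite (_ : (fun s => _) = (fun s => \sum_(c <- p j) complex.Re ((c.1 * \prod_(i <- c.2) z i) * cis (freq w c.2 * s)))); last first.
    by apply/funext => s; rewrite Re_sum; apply: eq_bigr => c _; rewrite E.
  rewrite Re_sum (eq_bigr (fun c => complex.Re ((0 +i* freq w c.2)%C * (c.1 * \prod_(i <- c.2) z i) * cis (freq w c.2 * t)))); last first.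
    by move=> c _; rewrite /= -!mulrA; congr (complex.Re (_ * _)); rewrite !mulrA -E.
  by apply: is_derive_sum_seq => c; have [] := is_derive_cis (c.1 * \prod_(i <- c.2) z i) (freq w c.2) t.
- rewrite (_ : (fun s => _) = (fun s => \sum_(c <- p j) complex.Im ((c.1 * \prod_(i <- c.2) z i) * cis (freq w c.2 * s)))); last first.
    by apply/funext => s; rewrite Im_sum; apply: eq_bigr => c _; rewrite E.
  rewrite Im_sum (eq_bigr (fun c => complex.Im ((0 +i* freq w c.2)%C * (c.1 * \prod_(i <- c.2) z i) * cis (freq w c.2 * t)))); last first.
    by move=> c _; rewrite /= -!mulrA; congr (complex.Im (_ * _)); rewrite !mulrA -E.
  by apply: is_derive_sum_seq => c; have [] := is_derive_cis (c.1 * \prod_(i <- c.2) z i) (freq w c.2) t.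
Qed.

Lemma wev_wderiv_Linv N j (p : seq (R[i] * tree n)) z : nonresonant w ->
  wev (wderiv (flat (Linv w N j p))) z =
  (0 +i* w j)%C * wev (flat (Linv w N j p)) z + wev (flat (ptrunc N p)) z.
Proof.
move=> nr; rewrite /wev /wderiv /flat /Linv !big_map /ptrunc !big_filter mulr_sumr -big_split/=.
apply: eq_bigr => -[c t] /= /andP[t1 _].
set d := freq w (leaves t) - w j; set P := \prod_(i <- _) _.
have d0 : d != 0.
  rewrite subr_eq0 -adot_count; apply/eqP; apply: nr; by rewrite msize_count.
have id0 : (0 +i* d)%C != 0 :> R[i] by rewrite eq_complex /= eqxx/=.
have -> : (0 +i* freq w (leaves t))%C = (0 +i* w j)%C + (0 +i* d)%C :> R[i].
  by apply/eqP; rewrite eq_complex /= addr0 eqxx/= addrC subrK.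
by field.
Qed.

Lemma all_psubst (f : seq (R[i] * word)) (H : 'I_n -> seq (R[i] * tree n)) :
  (forall c, c \in f -> (1 < size c.2)%N) -> all (fun a => 1 < tsize a.2)%N (psubst f H).
Proof.
move=> hf; elim: f hf => // c f IH hf.
rewrite /psubst /= all_cat -/(psubst f H) IH ?andbT; last by move=> e ef; rewrite hf// in_cons ef orbT.
rewrite all_map; have := hf c (mem_head _ _); case: (c.2) => [//|i [//|i' s]] _.
rewrite /= /pmul; elim: (H i) => // a p IHp; rewrite /= all_cat IHp andbT all_map.
by apply/allT => b /=; rewrite tsize_Node; have := tsize_gt0 a.2; have := tsize_gt0 b.2; lia.
Qed.

Lemma wnorm_flat X (p : seq (R[i] * tree n)) : wnorm X (flat p) = tnorm (fun a => X ^+ tsize a) p.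
Proof. by rewrite /wnorm /flat big_map. Qed.

Lemma wev_flat_cons a (p : seq (R[i] * tree n)) z :
  wev (flat (a :: p)) z = a.1 * \prod_(i <- leaves a.2) z i + wev (flat p) z.
Proof. by rewrite /wev /flat big_cons. Qed.

Lemma ptrunc_error N (p : seq (R[i] * tree n)) z X th :
  all (fun a => 1 < tsize a.2)%N p -> 0 <= X -> 0 <= th <= 1 -> vnorm z <= th * X ->
  cabs (wev (flat p) z - wev (flat (ptrunc N p)) z) <= th ^+ N.+1 * tnorm (fun a => X ^+ tsize a) p.
Proof.
move=> hp X0 t01 hz; have /andP[t0 t1] := t01.
elim: p hp => [|a p IH].
  by rewrite /wev /flat /tnorm !big_nil subrr cabs0 mulr0.
rewrite [all _ _]/= => /andP[ha /IH{}IH].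
rewrite /tnorm big_cons -/(tnorm _ p) mulrDr wev_flat_cons /ptrunc /= ha /= -/(ptrunc N p).
case: ifP => haN.
  rewrite wev_flat_cons opprD addrACA subrr add0r (le_trans IH)// lerDr.
  by apply: mulr_ge0; rewrite ?exprn_ge0// mulr_ge0 ?cabs_ge0 ?exprn_ge0.
rewrite -addrA; apply: (le_trans (cabsD _ _)); apply: lerD => //.
rewrite cabsM mulrCA ler_wpM2l ?cabs_ge0//.
apply: (le_trans (word_bound _ hz)); rewrite exprMn -/(tsize a.2) ler_wpM2r ?exprn_ge0//.
by rewrite ler_wiXn2l//; lia.
Qed.

Lemma tnorm_leaf (W : tree n -> R) j (p : seq (R[i] * tree n)) :
  tnorm W ((1, Leaf j) :: p) = W (Leaf j) + tnorm W p.
Proof.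
rewrite /tnorm big_cons; congr (_ + _).
by change (cabs (1 : R[i]) * W (Leaf j) = W (Leaf j)); rewrite cabs1 mul1r.
Qed.

Lemma wev_leaf j (p : seq (R[i] * tree n)) z :
  wev (flat ((1, Leaf j) :: p)) z = z j + wev (flat p) z.
Proof.
rewrite wev_flat_cons; congr (_ + _).
by change (1 * (\prod_(i <- [:: j]) z i) = z j); rewrite big_seq1 mul1r.
Qed.

Lemma wev_wderiv_cons a (p : seq (R[i] * tree n)) z :
  wev (wderiv (flat (a :: p))) z =
  (0 +i* freq w (leaves a.2))%C * a.1 * \prod_(i <- leaves a.2) z i + wev (wderiv (flat p)) z.
Proof. by rewrite /wev /wderiv /flat [map _ (_ :: _)]/= [map _ (_ :: _)]/= big_cons. Qed.

Lemma normal_form (F f : vec R n -> vec R n) (rho M s : R) (g : nat -> 'I_n -> seq (R[i] * word)) :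
  nonresonant w -> 0 < rho <= 2^-1 -> 1 <= M ->
  (forall z, inD1 z -> F z = (fun j => (0 +i* w j)%C * z j + f z j)) ->
  (forall N j e, e \in g N j -> (1 < size e.2 <= N)%N) ->
  (forall N j, wnorm rho (g N j) <= M) ->
  (forall N j z th, (0 < N)%N -> 0 <= th <= 1 -> vnorm z <= th * rho ->
     cabs (f z j - wev (g N j) z) <= 2 * (th ^+ N.+1 * M)) ->
  0 < s -> divisor_bound w s ->
  exists (r C : R) (N1 : nat), [/\ 0 < r <= rho / 8, 1 <= C &
    forall N, (N1 <= N)%N -> (0 < N)%N ->
    let R1 := r / (C * powR N%:R s) in
    0 < R1 <= r /\
    exists h : vec R n -> vec R n,
      [/\ (forall j, h (@vzero R n) j = 0),
        (forall z z' j, vnorm z <= R1 / 2 -> vnorm z' <= R1 / 2 ->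
           cabs (h z j - h z' j) <= 4^-1 * vnorm (vsub z z')) &
        (forall z, vnorm z <= R1 / 4 -> exists a : R -> vec R n,
          forall t, let u := fun t j => flow t z j + h (flow t z) j in
            deriv_curve u t (a t) /\ forall j, cabs (a t j - F (u t) j) <= R1 / 2 ^+ N)]].
Proof.
move=> nr /andP[rho0 rho2] M1 hFf gsize gnorm gtail s0 [C [C1 [N1 hdiv]]].
have M0 : 0 < M by lra.
(* [f] starts at degree 2, so its majorant on radius 2 X is at most (2 X / rho)^2 M = (X/4)(X/r).
   This closes the induction [HW] and is used again at X = R1. *)
pose r := rho ^+ 2 / (16 * M).
have r0 : 0 < r by rewrite divr_gt0 ?exprn_gt0// mulr_gt0.
have r8 : r <= rho / 8.
  rewrite /r ler_pdivrMr ?mulr_gt0// expr2 -mulrA ler_wpM2l ?(ltW rho0)//; lra.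
exists r, C, N1; split=> //; first by rewrite r0.
move=> N NN1 N0 R1.
set D := C * powR N%:R s in R1 *.
have D1 : 1 <= D.
  have h : 1 <= powR (N%:R : R) s.
    have N1r : (1 : R) <= N%:R by rewrite ler1n.
    by have := ler_powR N1r (ltW s0); rewrite powRr0.
  by rewrite /D; apply: (le_trans C1); apply: ler_peMr => //; lra.
have D0 : 0 < D by lra.
have R10 : 0 < R1 by rewrite divr_gt0.
have R1r : R1 <= r by rewrite ler_pdivrMr// ler_peMr// ltW.
split; first by rewrite R10.
have R1rho : R1 <= rho / 8 by apply: le_trans R1r r8.
have gsmall X j : 0 < X <= r -> wnorm (2 * X) (g N j) <= X / 4.
  move=> /andP[X0 Xr].
  have Xrho : X <= rho / 8 by apply: le_trans r8.
  have th01 : 0 <= 2 * X / rho <= 1.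
    by rewrite divr_ge0 ?mulr_ge0 ?(ltW rho0) ?(ltW X0)//= ler_pdivrMr//; lra.
  have -> : 2 * X = 2 * X / rho * rho by rewrite divfK// gt_eqF.
  apply: (le_trans (@wnorm_scale _ _ (g N j) rho (2 * X / rho) 2 (ltW rho0) th01 _)).
    by move=> e /gsize/andP[].
  apply: (le_trans (ler_wpM2l (sqr_ge0 _) (gnorm N j))).
  have -> : (2 * X / rho) ^+ 2 * M = (X / 4) * (X / r).
    by rewrite /r; field; rewrite (gt_eqF rho0) (gt_eqF M0).
  by rewrite ler_piMr ?divr_ge0 ?(ltW X0)// ler_pdivrMr// mul1r.
pose H k := Hiter w N (g N) k.
have gs i c : c \in g N i -> (1 < size c.2)%N by move=> /gsize/andP[].
pose eps := small_eps w.
(* Radius r with the divisors built into the weight: in this norm H is bounded independently of N,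
   and the arithmetic enters only in the passage to radius [R1]. *)
pose W (t : tree n) := r ^+ tsize t * tprod eps t.
have eps01 (t : tree n) : 0 <= eps t <= 1 by rewrite small_eps_ge0 small_eps_le1.
have tp0 (t : tree n) : 0 <= tprod eps t.
  elim: t => //= a Ha b Hb; rewrite !mulr_ge0//; by have /andP[] := eps01 (Node a b).
have W0 (t : tree n) : 0 <= W t by rewrite mulr_ge0 ?exprn_ge0// ltW.
have WN a b : W (Node a b) = eps (Node a b) * (W a * W b).
  by rewrite /W tsize_Node exprD /=; ring.
have WL i : W (Leaf i) = r by rewrite /W /tsize /= expr1 mulr1.
have HW k i : tnorm W (H k i) <= 2 * r.
  elim: k i => [|k IH] i.
    rewrite (_ : H 0%N i = [:: (1, Leaf i)])// tnorm_leaf WL /tnorm big_nil; lra.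
  rewrite (_ : H k.+1 i = (1, Leaf i) :: Linv w N i (psubst (g N i) (H k)))// tnorm_leaf WL.
  have := @tnorm_Linv_psubst R n w N i W eps (H k) (g N i) (2 * r) W0 eps01 WN _ IH (gs i).
  move=> /(_ (fun a _ => small_eps_le w a i)) h.
  have := le_trans h (gsmall r i _); rewrite r0 lexx => /(_ isT).
  lra.
pose hl j := Linv w N j (psubst (g N j) (H N)).
have HE j : H N j = (1, Leaf j) :: hl j by apply: Hiter_fixed.
have hlW j : tnorm W (hl j) <= r / 4.
  have := @tnorm_Linv_psubst R n w N j W eps (H N) (g N j) (2 * r) W0 eps01 WN _ (HW N) (gs j).
  move=> /(_ (fun a _ => small_eps_le w a j)) h.
  by have := le_trans h (gsmall r j _); rewrite r0 lexx => /(_ isT).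
have hlR j : wnorm R1 (flat (hl j)) <= R1 / 4.
  have -> : R1 / 4 = D^-1 * (r / 4) by rewrite /R1; ring.
  apply: le_trans (ler_wpM2l _ (hlW j)); last by rewrite invr_ge0 ltW.
  rewrite wnorm_flat /tnorm mulr_sumr.
  have := all_Linv w N j (psubst (g N j) (H N)); rewrite -/(hl j).
  elim: (hl j) => [|c p IH]; first by rewrite !big_nil.
  rewrite [all _ _]/= !big_cons => /andP[/andP[c1 cN] /IH{}IH]; apply: lerD => //.
  rewrite mulrCA ler_wpM2l ?cabs_ge0// /W.
  have := hdiv N NN1 N0 c.2 cN; rewrite -/D -/eps => hd.
  (* k leaves but k - 1 nodes: the divisors use up k - 1 of the factors 1/D, and the remaining one
     turns r/4 into R1/4. *)
  have -> : R1 ^+ tsize c.2 = D^-1 * (r ^+ tsize c.2 * (D ^+ nodes c.2)^-1).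
    rewrite /R1 expr_div_n {2}tsize_nodes exprS invfM; ring.
  apply: ler_wpM2l; first by rewrite invr_ge0 ltW.
  by apply: ler_wpM2l => //; rewrite exprn_ge0// ltW.
have HR j : tnorm (fun a => R1 ^+ tsize a) (H N j) <= 2 * R1.
  rewrite HE tnorm_leaf {1}/tsize /= expr1.
  have := hlR j; rewrite wnorm_flat; lra.
pose h z : vec R n := fun j => wev (flat (hl j)) z.
have wev0 j : h (@vzero R n) j = 0.
  rewrite /h /wev big_map big1// => -[c t] _ /=.
  have := tsize_gt0 t; rewrite /tsize; case: (leaves t) => // i l _.
  by rewrite big_cons /vzero mul0r mulr0.
have hlip z z' j : vnorm z <= R1 / 2 -> vnorm z' <= R1 / 2 ->
    cabs (h z j - h z' j) <= 4^-1 * vnorm (vsub z z').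
  move=> hz hz'; apply: (le_trans (wev_lipschitz (flat (hl j)) R10 hz hz')).
  rewrite ler_wpM2r ?vnorm_ge0// ler_pdivrMr//; have := hlR j; lra.
exists h; split => // z hz.
exists (fun t j => wev (wderiv (flat (H N j))) (flow t z)) => t u.
have uE x j : u x j = wev (flat (H N j)) (flow x z).
  by rewrite HE wev_leaf.
have fz : vnorm (flow t z) <= R1 / 4 by rewrite vnorm_flow.
have uEf : u = fun x j => wev (flat (H N j)) (flow x z) by apply/funext => x; apply/funext.
split; first by rewrite uEf; exact: deriv_curve_flow.
have v0 : vnorm (@vzero R n) <= R1 / 2.
  have R2 : 0 <= R1 / 2 by rewrite divr_ge0// ltW.
  by apply: vnorm_le => // j; rewrite /vzero cabs0.
have hu : vnorm (u t) <= 2^-1 * (R1 / rho) * rho.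
  have -> : 2^-1 * (R1 / rho) * rho = R1 / 2 by field; rewrite gt_eqF.
  apply: vnorm_le => [|j]; first by rewrite divr_ge0// ltW.
  apply: (le_trans (cabsD _ _)).
  have h1 := le_trans (cabs_le_vnorm (flow t z) j) fz.
  have := hlip (flow t z) (@vzero R n) j; rewrite wev0 subr0 => /(_ _ v0).
  have -> : vsub (flow t z) (@vzero R n) = flow t z by apply/funext => i; rewrite /vsub subr0.
  move=> h2; have {}h2 := h2 ltac:(lra).
  by move: h1 h2; lra.
have th01 : 0 <= 2^-1 * (R1 / rho) <= 1.
  have Rr0 : 0 <= R1 / rho := divr_ge0 (ltW R10) (ltW rho0).
  apply/andP; split; first lra.
  by rewrite mulrA ler_pdivrMr//; lra.
have uD : inD1 (u t).
  move=> j; apply: (le_lt_trans (cabs_le_vnorm _ _)); apply: (le_lt_trans hu).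
  have /andP[_ h1] := th01; apply: (@le_lt_trans _ _ (1 * rho)); last by lra.
  by rewrite ler_wpM2r// ltW.
move=> j.
have err1 := gtail N j (u t) _ N0 th01 hu.
have e4 : 0 <= (4^-1 : R) <= 1 by apply/andP; split; lra.
have fz4 : vnorm (flow t z) <= 4^-1 * R1 by lra.
have err2 := @ptrunc_error N (psubst (g N j) (H N)) (flow t z) R1 4^-1 (all_psubst (H N) (gs j)) (ltW R10) e4 fz4.
have nsub : tnorm (fun a => R1 ^+ tsize a) (psubst (g N j) (H N)) <= R1 / 4.
  apply: le_trans (gsmall R1 j _); last by rewrite R10.
  apply: (@tnorm_psubst R n _ (fun a => R1 ^+ tsize a)) => //.
  - by move=> a; rewrite exprn_ge0// ltW.
  - by move=> a b; rewrite tsize_Node exprD.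
  - by move=> a b; rewrite tsize_Node exprD.
  - exact: gs.
rewrite (hFf _ uD) HE.
have -> : wev (wderiv (flat ((1, Leaf j) :: hl j))) (flow t z) =
  (0 +i* w j)%C * u t j + wev (flat (ptrunc N (psubst (g N j) (H N)))) (flow t z).
  have E : wev (wderiv (flat ((1, Leaf j) :: hl j))) (flow t z) =
    (0 +i* freq w [:: j])%C * 1 * (\prod_(i <- [:: j]) flow t z i) + wev (wderiv (flat (hl j))) (flow t z).
    exact: wev_wderiv_cons.
  rewrite E wev_wderiv_Linv// -/(hl j) big_seq1 /freq big_seq1 mulr1 /u /h mulrDr.
  by rewrite addrA.
have sub : wev (flat (psubst (g N j) (H N))) (flow t z) = wev (g N j) (u t).
  rewrite wev_psubst; last by move=> c /gs; exact: ltnW.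
  by congr wev; apply/funext => i; rewrite uE.
set T := wev (flat (ptrunc _ _)) _ in err2 *.
(* The defect has two sources: the Taylor tail of [f], with ratio R1 / (2 rho), and the terms of f o
   H of degree above N, with ratio 1/4. *)
have -> : (0 +i* w j)%C * u t j + T - ((0 +i* w j)%C * u t j + f (u t) j) =
  - (f (u t) j - wev (g N j) (u t)) - (wev (flat (psubst (g N j) (H N))) (flow t z) - T).
  by rewrite sub; ring.
apply: (le_trans (cabsB _ _)); rewrite cabsN.
apply: (le_trans (lerD err1 err2)).
(* The halves supply 2^-(N+1); two of the N + 1 powers of R1 / rho are kept, possible as N > 0, and
   they supply the factor R1. *)
have b1 : (2^-1 * (R1 / rho)) ^+ N.+1 * M <= (2 ^+ N.+1)^-1 * (R1 / 16).
  rewrite exprMn exprVn -mulrA ler_wpM2l ?invr_ge0 ?exprn_ge0//.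
  apply: (@le_trans _ _ ((R1 / rho) ^+ 2 * M)).
    apply: ler_wpM2r; first exact: ltW.
    apply: ler_wiXn2l => //; first exact: divr_ge0 (ltW R10) (ltW rho0).
    by rewrite ler_pdivrMr//; lra.
  have -> : (R1 / rho) ^+ 2 * M = R1 / 16 * (R1 / r).
    by rewrite /r; field; rewrite (gt_eqF rho0) (gt_eqF M0).
  by apply: ler_piMr; [rewrite divr_ge0// ltW|rewrite ler_pdivrMr// mul1r].
have b2 : 4^-1 ^+ N.+1 * (R1 / 4) <= (2 ^+ N.+1)^-1 * (R1 / 4).
  apply: ler_wpM2r; first by rewrite divr_ge0// ltW.
  by rewrite exprVn lef_pV2 ?posrE ?exprn_gt0// ler_pXn2r// ?nnegrE//; lra.
have b3 := ler_wpM2l (exprn_ge0 N.+1 (proj1 (andP e4))) nsub.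
have b4 : (2 ^+ N.+1)^-1 = 2^-1 / 2 ^+ N :> R by rewrite exprS invfM.
rewrite b4 in b1 b2.
have p0 : 0 <= (2 ^+ N)^-1 * R1 by rewrite mulr_ge0 ?invr_ge0 ?exprn_ge0// ltW.
rewrite mulrC; lra.
Qed.

End NormalForm.

(** * Long-time stability *)

Section Stability.
Variables (R : realType) (n : nat).
Implicit Types (z : vec R n).

(** Fixed-point iteration for z = y - h z from [z0]. It recovers the linearising coordinate of a
    point close to the image of a known one, and the norm grows only by a multiple of the mismatch
    [del]. *)
Lemma near_identity_solve (h : vec R n -> vec R n) (rho del : R) z0 y :
  (forall z z' j, vnorm z <= rho -> vnorm z' <= rho ->
     cabs (h z j - h z' j) <= 4^-1 * vnorm (vsub z z')) ->
  (forall j, cabs (y j - (z0 j + h z0 j)) <= del) -> vnorm z0 + 4 * del <= rho -> 0 <= del ->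
  exists z, (forall j, z j + h z j = y j) /\ vnorm z <= vnorm z0 + 4 * del.
Proof.
move=> hlip hy hrho del0.
pose u := fun k => iter k (fun z : vec R n => (fun j => y j - h z j) : vec R n) z0.
have uS k j : u k.+1 j = y j - h (u k) j by [].
have dk k : 0 <= del / 2 ^+ k by rewrite divr_ge0// exprn_ge0.
have dS k : del / 2 ^+ k.+1 = 2^-1 * (del / 2 ^+ k) by rewrite exprS invfM; ring.
have step k : (forall j, cabs (u k.+1 j - u k j) <= del / 2 ^+ k) /\
   (forall j, cabs (u k j - z0 j) <= 2 * del - 2 * (del / 2 ^+ k)).
  elim: k => [|k [IH1 IH2]].
    split=> j.
      rewrite expr0 divr1 uS (_ : y j - h _ j - _ = y j - (z0 j + h z0 j))//=.
      by rewrite /u /=; ring.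
    by rewrite expr0 divr1 !subrr cabs0.
  have H2 j : cabs (u k.+1 j - z0 j) <= 2 * del - 2 * (del / 2 ^+ k.+1).
    have -> : u k.+1 j - z0 j = (u k.+1 j - u k j) + (u k j - z0 j) by ring.
    apply: (le_trans (cabsD _ _)); have := IH1 j; have := IH2 j; rewrite dS; lra.
  have inb (v : vec R n) (c : R) : (forall j, cabs (v j - z0 j) <= c) -> 0 <= c -> c <= 2 * del -> vnorm v <= rho.
    move=> hv c0 hc; apply: (le_trans (vnorm_triangle v z0)).
    have : vnorm (vsub v z0) <= c by apply: vnorm_le.
    lra.
  split=> // j; rewrite uS uS.
  have -> : y j - h (u k.+1) j - (y j - h (u k) j) = h (u k) j - h (u k.+1) j by ring.
  have d1 := dk k; have d2 := dk k.+1.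
  have dk1 : del / 2 ^+ k <= del.
    by rewrite ler_pdivrMr ?exprn_gt0// ler_peMr// exprn_ege1// ler1n.
  have dk2 : del / 2 ^+ k.+1 <= del by rewrite dS; lra.
  apply: (le_trans (hlip _ _ _ _ _)).
  - by apply: (inb _ _ IH2); lra.
  - by apply: (inb _ _ H2); lra.
  have : vnorm (vsub (u k) (u k.+1)) <= del / 2 ^+ k.
    by apply: vnorm_le => // i; rewrite /vsub cabsC.
  by rewrite dS; lra.
have /choice[l hl] j : exists l, forall k, cabs (l - u k j) <= 4 * del / 2 ^+ k.
  by apply: geometric_climit => k; have [] := step k.
have l0 : vnorm (vsub l z0) <= 4 * del.
  by apply: vnorm_le => [|j]; [lra|have := hl j 0%N; rewrite expr0 divr1].
have lr : vnorm l <= vnorm z0 + 4 * del by apply: (le_trans (vnorm_triangle l z0)); lra.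
exists l; split=> // j; apply/eqP; rewrite -subr_eq0 -cabs_eq0 eq_le cabs_ge0 andbT.
apply: (@le_geometric_le _ _ _ (8 * del)) => k; rewrite add0r.
have -> : l j + h l j - y j = (l j - u k.+1 j) + (h l j - h (u k) j) by rewrite uS; ring.
have [h1 h2] := step k.
have dk1 := dk k.
have ur : vnorm (u k) <= rho.
  apply: (le_trans (vnorm_triangle (u k) z0)).
  have : vnorm (vsub (u k) z0) <= 2 * del.
    by apply: vnorm_le => [|i]; [lra|apply: (le_trans (h2 i)); lra].
  lra.
have lk : vnorm (vsub l (u k)) <= 4 * (del / 2 ^+ k).
  by apply: vnorm_le => [|i]; [lra|rewrite mulrA; exact: hl].
have h3 := hlip l (u k) j (le_trans lr hrho) ur.
have h4 := hl j k.+1; rewrite -mulrA dS in h4.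
apply: (le_trans (cabsD _ _)).
by rewrite -mulrA; lra.
Qed.

Definition clamp (b x : R) : R := Num.max (- b) (Num.min b x).

Lemma clamp_lip b x y : `|clamp b x - clamp b y| <= `|x - y|.
Proof.
rewrite /clamp /Num.max /Num.min.
have h1 := ler_norm (x - y); have h2 := ler_norm (y - x); rewrite (distrC y x) in h2.
have h3 := normr_ge0 (x - y).
by rewrite ler_norml; case: (ltP b x) => ?; case: (ltP b y) => ?; do ![case: (ltP (- b)) => ?];
  apply/andP; split; lra.
Qed.

Lemma clamp_bound b x : 0 <= b -> `|clamp b x| <= b.
Proof.
move=> b0; rewrite /clamp /Num.max /Num.min ler_norml.
by case: (ltP b x) => ?; do ![case: (ltP (- b)) => ?]; apply/andP; split; lra.
Qed.

Lemma clamp_id b x : `|x| <= b -> clamp b x = x.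
Proof.
rewrite ler_norml => /andP[h1 h2]; rewrite /clamp (min_idPr h2); exact: (max_idPr h1).
Qed.

(** Precomposing [F] with it gives a bounded, globally Lipschitz field, unchanged on the ball of
    radius b. Real and imaginary parts are cut separately, hence the factors 2 in its bounds. *)
Definition vclamp b z : vec R n :=
  fun j => (clamp b (complex.Re (z j)) +i* clamp b (complex.Im (z j)))%C.

Lemma vclamp_lip b z z' : vnorm (vsub (vclamp b z) (vclamp b z')) <= 2 * vnorm (vsub z z').
Proof.
apply: vnorm_le => [|j]; first by rewrite mulr_ge0 ?vnorm_ge0.
apply: cabs_le2; rewrite ?ReB ?ImB /=; apply: (le_trans (clamp_lip _ _ _));
  rewrite -?ReB -?ImB; apply: le_trans (cabs_le_vnorm (vsub z z') j).
- exact: Re_le_cabs.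
- exact: Im_le_cabs.
Qed.

Lemma vclamp_bound b z : 0 <= b -> vnorm (vclamp b z) <= 2 * b.
Proof. by move=> b0; apply: vnorm_le => [|j]; [lra|apply: cabs_le2; exact: clamp_bound]. Qed.

Lemma vclamp_id b z : vnorm z <= b -> vclamp b z = z.
Proof.
move=> zb; apply/funext => j; rewrite /vclamp !clamp_id.
- by case: (z j).
- exact: le_trans (Im_le_cabs _) (le_trans (cabs_le_vnorm z j) zb).
- exact: le_trans (Re_le_cabs _) (le_trans (cabs_le_vnorm z j) zb).
Qed.

Lemma deriv_curve_shift (u : R -> vec R n) t0 t (a : vec R n) :
  deriv_curve u (t0 + t) a -> deriv_curve (fun s => u (t0 + s)) t a.
Proof.
move=> h j; have [h1 h2] := h j.
have hs : is_derive t (1 : R) (fun s => t0 + s) 1.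
  rewrite -[X in is_derive _ _ _ X](add0r 1).
  exact: (is_deriveD (is_derive_cst _ _ _) (is_derive_id _ _)).
split.
- have := @is_derive1_comp R _ (fun s => t0 + s) t _ 1 h1 hs.
  by rewrite mulr1.
- have := @is_derive1_comp R _ (fun s => t0 + s) t _ 1 h2 hs.
  by rewrite mulr1.
Qed.

(* Any bound m on the distance improves to m / 2 + 2 tau eta; iterate. *)
Lemma defect_step (G : vec R n -> vec R n) (L B tau eta : R) (z u a : R -> vec R n) :
  0 <= L -> 0 <= B -> 0 <= tau -> 4 * L * tau <= 1 -> 0 <= eta ->
  (forall x y j, cabs (G x j - G y j) <= L * vnorm (vsub x y)) ->
  (forall x j, cabs (G x j) <= B) ->
  (forall t, deriv_curve z t (G (z t))) -> (forall t, deriv_curve u t (a t)) ->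
  (forall t j, cabs (a t j - G (u t) j) <= eta) -> z 0 = u 0 ->
  forall t j, `|t| <= tau -> cabs (z t j - u t j) <= 4 * tau * eta.
Proof.
move=> L0 B0 tau0 Ltau eta0 GL GB dz du ha zu.
pose P (m : R) := forall t j, `|t| <= tau -> cabs (z t j - u t j) <= m.
have step (D : R) : 0 <= D -> (forall t j, `|t| <= tau -> cabs (G (z t) j - a t j) <= D) -> P (2 * (D * tau)).
  move=> D0 hD t j ht.
  have h := @curve_mvt R n (fun s => vsub (z s) (u s)) (fun s => vsub (G (z s)) (a s)) 0 t D _ j.
  have {}h := h _; rewrite /vsub zu subrr !subr0 in h.
  apply: le_trans (h _) _.
    move=> s hs; split; first by apply: deriv_curve_sub.
    move=> i; apply: hD; apply: le_trans ht.
    move: hs; rewrite ge_min le_max => /andP[].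
    by move=> /orP[] h1 /orP[] h2; rewrite ler_norml; move: (ler_norm t) (ler_norm (-t)); rewrite normrN; move=> ? ?; apply/andP; split; lra.
  by rewrite ler_wpM2l// ler_wpM2l.
(* Boundedness of [G] supplies a first, crude bound to iterate from. *)
have it0 : P (2 * ((2 * B + eta) * tau)).
  apply: step => [|t j _]; first by lra.
  have -> : G (z t) j - a t j = (G (z t) j - G (u t) j) - (a t j - G (u t) j) by ring.
  apply: (le_trans (cabsB _ _)); apply: lerD => //.
  by apply: (le_trans (cabsB _ _)); have := GB (z t) j; have := GB (u t) j; lra.
have itS m : 0 <= m -> P m -> P (2 * ((L * m + eta) * tau)).
  move=> m0 Pm; apply: step => [|t j ht]; first by rewrite addr_ge0// mulr_ge0.
  have -> : G (z t) j - a t j = (G (z t) j - G (u t) j) - (a t j - G (u t) j) by ring.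
  apply: (le_trans (cabsB _ _)); apply: lerD => //; apply: (le_trans (GL _ _ _)).
  by rewrite ler_wpM2l//; apply: vnorm_le => // i; exact: Pm.
set m0 := 2 * ((2 * B + eta) * tau) in it0.
have m00 : 0 <= m0 by rewrite mulr_ge0// mulr_ge0//; lra.
have te : 0 <= tau * eta by exact: mulr_ge0.
have itk k : P (4 * tau * eta + m0 / 2 ^+ k).
  elim: k => [|k IH] t j ht.
    by rewrite expr0 divr1; apply: (le_trans (it0 t j ht)); lra.
  have mk : 0 <= m0 / 2 ^+ k by rewrite divr_ge0// exprn_ge0.
  apply: (le_trans (itS _ _ IH t j ht)); first by lra.
  have -> : m0 / 2 ^+ k.+1 = 2^-1 * (m0 / 2 ^+ k) by rewrite exprS invfM; ring.
  set q := m0 / 2 ^+ k in mk *.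
  have h1 := ler_wpM2r te Ltau; have h2 := ler_wpM2r mk Ltau; lra.
by move=> t j ht; apply: (@le_geometric_le _ _ _ m0) => k; exact: itk.
Qed.

Lemma long_time_solution (F h : vec R n -> vec R n) (w : 'I_n -> R) (L B b tau R1 eta : R) z0 :
  0 <= L -> 0 <= B -> 0 < tau -> 8 * L * tau <= 1 -> 0 < R1 -> R1 <= b -> 0 <= eta ->
  16 * tau * eta <= R1 / 8 ->
  (forall x y j, vnorm x <= 2 * b -> vnorm y <= 2 * b -> cabs (F x j - F y j) <= L * vnorm (vsub x y)) ->
  (forall x j, vnorm x <= 2 * b -> cabs (F x j) <= B) ->
  (forall j, h (@vzero R n) j = 0) ->
  (forall z z' j, vnorm z <= R1 / 2 -> vnorm z' <= R1 / 2 ->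
     cabs (h z j - h z' j) <= 4^-1 * vnorm (vsub z z')) ->
  (forall z, vnorm z <= R1 / 4 -> exists a : R -> vec R n,
     forall t, let u := fun t j => flow w t z j + h (flow w t z) j in
       deriv_curve u t (a t) /\ forall j, cabs (a t j - F (u t) j) <= eta) ->
  vnorm z0 <= R1 / 16 ->
  exists z : R -> vec R n, z 0 = z0 /\ forall t, 128 * `|t| * eta <= R1 ->
    vnorm (z t) <= R1 /\ deriv_curve z t (F (z t)).
Proof.
move=> L0 B0 tau0 Ltau R10 R1b eta0 hte FL FB h0 hlip hcurve hz0.
have b0 : 0 < b by lra.
pose G x := F (vclamp b x).
have cb x : vnorm (vclamp b x) <= 2 * b by apply: vclamp_bound; exact: ltW.
have GL x y j : cabs (G x j - G y j) <= 2 * L * vnorm (vsub x y).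
  apply: (le_trans (FL _ _ _ (cb x) (cb y))).
  by have := ler_wpM2l L0 (vclamp_lip b x y); lra.
have GB x j : cabs (G x j) <= B by apply: FB.
have L20 : 0 <= 2 * L by lra.
have [z [z00 dz]] := picard z0 L20 B0 GL GB.
have hsmall v j : vnorm v <= R1 / 2 -> cabs (h v j) <= 4^-1 * vnorm v.
  move=> hv; have := hlip v (@vzero R n) j hv; rewrite h0 subr0.
  have -> : vsub v (@vzero R n) = v by apply/funext => i; rewrite /vsub subr0.
  apply; apply: vnorm_le => [|i]; first lra.
  by rewrite /vzero cabs0; lra.
have ubound v t : vnorm v <= R1 / 4 ->
    vnorm (fun j => flow w t v j + h (flow w t v) j) <= 5 / 16 * R1.
  move=> hv; apply: vnorm_le => [|j]; first lra.
  apply: (le_trans (cabsD _ _)).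
  have h1 := cabs_le_vnorm (flow w t v) j; rewrite vnorm_flow in h1.
  have := hsmall (flow w t v) j; rewrite vnorm_flow => h2.
  by have := h2 ltac:(lra); lra.
have teta : 0 <= tau * eta by rewrite mulr_ge0// ltW.
have step t0 v : vnorm v <= R1 / 4 -> (forall j, v j + h v j = z t0 j) ->
   (forall t, `|t| <= tau -> vnorm (z (t0 + t)) <= R1 / 2) /\
   (forall t, `|t| <= tau -> exists v', vnorm v' <= vnorm v + 16 * (tau * eta) /\
       forall j, v' j + h v' j = z (t0 + t) j).
  move=> hv zv; have [a hacurve] := hcurve v hv.
  set u := (fun t j => flow w t v j + h (flow w t v) j) in hacurve.
  have ub t : vnorm (u t) <= 5 / 16 * R1 by exact: ubound.
  have Gu t : G (u t) = F (u t) by rewrite /G vclamp_id//; have := ub t; lra.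
  have close t j : `|t| <= tau -> cabs (z (t0 + t) j - u t j) <= 4 * tau * eta.
    apply: (@defect_step G (2 * L) B tau eta (fun t => z (t0 + t)) u a) => //.
    - exact: ltW.
    - by lra.
    - by move=> s; apply: deriv_curve_shift; exact: dz.
    - by move=> s; have [] := hacurve s.
    - by move=> s i; rewrite Gu; have [_] := hacurve s; apply.
    - by apply/funext => i; rewrite addr0 -zv /u flow0.
  split=> t ht.
    apply: (le_trans (vnorm_triangle (z (t0 + t)) (u t))).
    have : vnorm (vsub (z (t0 + t)) (u t)) <= 4 * tau * eta.
      by apply: vnorm_le => [|j]; [lra|exact: close].
    by have := ub t; lra.
  have [|||v' [h1 h2]] := @near_identity_solve h (R1 / 2) (4 * tau * eta) (flow w t v) (z (t0 + t)) hlip.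
  - by move=> j; exact: close.
  - by rewrite vnorm_flow; lra.
  - by lra.
  exists v'; split=> //; rewrite vnorm_flow in h2; lra.
have [|||v0 [hv0 nv0]] := @near_identity_solve h (R1 / 2) (4^-1 * vnorm z0) z0 z0 hlip.
- move=> j; rewrite opprD addrA subrr sub0r cabsN; apply: hsmall; lra.
- by have := vnorm_ge0 z0; lra.
- by have := vnorm_ge0 z0; lra.
(* Invariant after k steps in the time direction [sg]. The linear flow preserves |v| and solving for
   the new v costs 4 (4 tau eta), so the growth is additive. At the start |v0| <= 2 |z0| <= R1/8,
   and the restriction on t keeps |v| below R1/4. *)
have iter (sg : R) k : `|sg| = 1 -> 16 * (k%:R * tau * eta) <= R1 / 8 ->
   exists v, vnorm v <= R1 / 8 + 16 * (k%:R * tau * eta) /\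
     forall j, v j + h v j = z (sg * (k%:R * tau)) j.
  move=> hsg; elim: k => [|k IH] hk.
    by exists v0; rewrite !mul0r !mulr0 z00; split=> //; lra.
  rewrite -natr1 !mulrDl mul1r in hk *.
  have [|v [hv hz]] := IH; first by lra.
  have [_ /(_ (sg * tau))] := step (sg * (k%:R * tau)) v ltac:(lra) hz.
  rewrite normrM hsg mul1r (gtr0_norm tau0) lexx => /(_ isT)[v' [hv' hz']].
  by exists v'; split; [lra|rewrite -natr1 mulrDl mul1r mulrDr].
exists z; split=> // t ht.
pose sg : R := if 0 <= t then 1 else -1.
have sg1 : `|sg| = 1 by rewrite /sg; case: ifP => _; rewrite ?normrN normr1.
have tE : t = sg * `|t| by rewrite /sg; case: ger0P => _; rewrite ?mul1r ?mulN1r ?opprK.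
pose k := Num.truncn (`|t| / tau).
have k1 : k%:R * tau <= `|t|.
  by rewrite -ler_pdivlMr// truncn_le// divr_ge0// ltW.
have k2 : `|t| - k%:R * tau <= tau.
  have := truncnS_gt (`|t| / tau); rewrite -/k ltr_pdivrMr// -natr1 mulrDl mul1r; lra.
have hk : 16 * (k%:R * tau * eta) <= R1 / 8.
  by have := ler_wpM2r eta0 k1; lra.
have [v [hv hz]] := iter sg k sg1 hk.
have [hb _] := step (sg * (k%:R * tau)) v ltac:(lra) hz.
have := hb (sg * (`|t| - k%:R * tau)).
have -> : sg * (k%:R * tau) + sg * (`|t| - k%:R * tau) = t by rewrite -mulrDr addrC subrK -tE.
rewrite normrM sg1 mul1r ger0_norm ?subr_ge0// => /(_ k2) hzt.
split; first lra.
(* The solution stays in the ball of radius b, where the clamp is the identity. *)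
by have := dz t; rewrite /G vclamp_id//; lra.
Qed.

End Stability.

(** * Choice of the constants *)

Section Assembly.
Variables (R : realType) (n : nat).
Implicit Types (z : vec R n).

(** On the half polydisc [f] is the limit of the polynomials [g N], whose Lipschitz constants are
    all at most M / rho. *)
Lemma field_lipschitz (w : 'I_n -> R) (F f : vec R n -> vec R n) (rho M : R)
    (g : nat -> 'I_n -> seq (R[i] * seq 'I_n)) :
  0 < rho <= 2^-1 -> 1 <= M ->
  (forall z, inD1 z -> F z = (fun j => (0 +i* w j)%C * z j + f z j)) ->
  (forall N j, wnorm rho (g N j) <= M) ->
  (forall N j z th, (0 < N)%N -> 0 <= th <= 1 -> vnorm z <= th * rho ->
     cabs (f z j - wev (g N j) z) <= 2 * (th ^+ N.+1 * M)) ->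
  exists2 L : R, 0 <= L & forall z z' j, vnorm z <= rho / 2 -> vnorm z' <= rho / 2 ->
    cabs (F z j - F z' j) <= L * vnorm (vsub z z').
Proof.
move=> /andP[rho0 rho2] M1 hFf gnorm gtail.
have Mr0 : 0 <= M / rho by rewrite divr_ge0// ?(ltW rho0)//; lra.
have inD z : vnorm z <= rho / 2 -> @inD1 R n z.
  by move=> hz j; apply: (le_lt_trans (cabs_le_vnorm z j)); lra.
have flip z z' j : vnorm z <= rho / 2 -> vnorm z' <= rho / 2 ->
    cabs (f z j - f z' j) <= M / rho * vnorm (vsub z z').
  move=> hz hz'; apply: (@le_geometric_le _ _ _ (4 * M)) => k.
  have th : 0 <= (2^-1 : R) <= 1 by apply/andP; split; lra.
  have t1 := @gtail k.+1 j z 2^-1 isT th ltac:(lra).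
  have t2 := @gtail k.+1 j z' 2^-1 isT th ltac:(lra).
  have t3 := wev_lipschitz (g k.+1 j) rho0 hz hz'.
  have t4 : wnorm rho (g k.+1 j) / rho * vnorm (vsub z z') <= M / rho * vnorm (vsub z z').
    by rewrite ler_wpM2r ?vnorm_ge0// ler_wpM2r ?invr_ge0 ?(ltW rho0).
  have -> : f z j - f z' j = (f z j - wev (g k.+1 j) z) +
    (wev (g k.+1 j) z - wev (g k.+1 j) z') - (f z' j - wev (g k.+1 j) z') by ring.
  apply: (le_trans (cabsB _ _)); apply: (le_trans (lerD (cabsD _ _) (lexx _))).
  have E : (2^-1 : R) ^+ k.+2 = 4^-1 * (2 ^+ k)^-1 by rewrite !exprS exprVn; field; rewrite expf_neq0.
  rewrite E in t1 t2; have : 0 <= (2 ^+ k)^-1 * M by rewrite mulr_ge0 ?invr_ge0 ?exprn_ge0//; lra.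
  rewrite -(mulrA _ M) (mulrC M); lra.
exists (\sum_j `|w j| + M / rho); first by rewrite addr_ge0// sumr_ge0.
move=> z z' j hz hz'; rewrite !hFf; [|exact: inD|exact: inD].
have -> : (0 +i* w j)%C * z j + f z j - ((0 +i* w j)%C * z' j + f z' j) =
  (0 +i* w j)%C * (z j - z' j) + (f z j - f z' j) by ring.
apply: (le_trans (cabsD _ _)); rewrite mulrDl; apply: lerD; last exact: flip.
rewrite cabsM cabs_imag; apply: ler_pM; rewrite ?cabs_ge0//.
  by rewrite (bigD1 j)//= lerDl sumr_ge0.
exact: (cabs_le_vnorm (vsub z z')).
Qed.

Lemma stability_at_order (F h : vec R n -> vec R n) (w : 'I_n -> R) (L b R1 : R) N z0 :
  0 <= L -> 0 < b -> 0 < R1 <= b -> R1 <= 1 -> F (@vzero R n) = @vzero R n ->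
  (forall x y j, vnorm x <= 2 * b -> vnorm y <= 2 * b -> cabs (F x j - F y j) <= L * vnorm (vsub x y)) ->
  (forall j, h (@vzero R n) j = 0) ->
  (forall z z' j, vnorm z <= R1 / 2 -> vnorm z' <= R1 / 2 ->
     cabs (h z j - h z' j) <= 4^-1 * vnorm (vsub z z')) ->
  (forall z, vnorm z <= R1 / 4 -> exists a : R -> vec R n,
     forall t, let u := fun t j => flow w t z j + h (flow w t z) j in
       deriv_curve u t (a t) /\ forall j, cabs (a t j - F (u t) j) <= R1 / 2 ^+ N) ->
  vnorm z0 <= R1 / 16 ->
  exists z : R -> vec R n, z 0 = z0 /\ forall t, `|t| <= 2 ^+ N / 128 ->
    vnorm (z t) <= R1 /\ deriv_curve z t (F (z t)).
Proof.
move=> L0 b0 /andP[R10 R1b] R11 F0 Flip h0 hlip hcurve hz0.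
have p2 : (0 : R) < 2 ^+ N by rewrite exprn_gt0.
have v00 : vnorm (@vzero R n) <= 2 * b.
  by apply: vnorm_le => [|j]; rewrite /vzero ?cabs0; lra.
have Fbd z j : vnorm z <= 2 * b -> cabs (F z j) <= L * (2 * b).
  move=> hz; have := Flip z (@vzero R n) j hz v00; rewrite F0 subr0 => /le_trans; apply.
  have -> : vsub z (@vzero R n) = z by apply/funext => i; rewrite /vsub subr0.
  by rewrite ler_wpM2l.
pose eta := R1 / 2 ^+ N.
have eta0 : 0 <= eta by apply: divr_ge0; exact: ltW.
have etaR : eta <= R1 by rewrite ler_pdivrMr// ler_peMr ?(ltW R10)// exprn_ege1// ler1n.
(* tau depends on L only; 16/128 = 1/8 and [eta <= R1] give [hte], and L + 1 covers the case L =
   0. *)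
pose tau := (128 * (L + 1))^-1.
have tau0 : 0 < tau by rewrite invr_gt0 mulr_gt0// ltr_wpDl.
have tauE : tau * (L + 1) = 128^-1.
  by rewrite /tau invfM -mulrA mulVf ?mulr1// gt_eqF// ltr_wpDl.
have tauL : 0 <= tau * L by rewrite mulr_ge0// ltW.
rewrite mulrDr mulr1 in tauE.
have t1 : tau <= 128^-1 by rewrite -tauE lerDr.
have Ltau : 8 * L * tau <= 1 by clear -tauE tau0; lra.
have hte : 16 * tau * eta <= R1 / 8.
  by have := ler_pM (ltW tau0) eta0 t1 etaR; clear -R10; lra.
have LB : 0 <= L * (2 * b) by rewrite mulr_ge0// mulr_ge0// ltW.
have [z [zz0 hz]] := long_time_solution L0 LB tau0 Ltau R10 R1b eta0 hte Flip Fbd h0 hlip hcurve hz0.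
exists z; split=> // t ht; apply: hz.
have : 128 * `|t| * eta <= 2 ^+ N * eta.
  by apply: ler_wpM2r => //; rewrite mulrC -ler_pdivlMr.
by move=> /le_trans; apply; rewrite /eta mulrCA divff ?mulr1// gt_eqF.
Qed.

End Assembly.

(** N is the integer part of x = (c/v)^(1/s), the largest order with N^s <= c/v. From N + 1 > x
    follows 2^(N+1) >= exp(x ln 2), and x = (c/r)^(1/s) (r/v)^(1/s) gives [B]. The bound [r0] forces
    N past [N1]. *)
Lemma optimal_order (R : realType) (c s : R) (N1 : nat) : 0 < c -> 0 < s ->
  exists2 r0 : R, 0 < r0 & forall r, 0 < r -> r < r0 ->
  exists2 B : R, 0 < B & forall v, 0 < v -> v < r -> exists N : nat,
    [/\ (N1 <= N)%N, (0 < N)%N, powR N%:R s <= c / v &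
      expR (B * powR (r / v) s^-1) <= 2 ^+ N.+1].
Proof.
move=> c0 s0; pose N2 : R := (maxn N1 1).+1%:R.
have N20 : 0 < N2 by rewrite ltr0n.
exists (c / powR N2 s); first by rewrite divr_gt0// powR_gt0.
move=> r r0 rr0; exists (ln 2 * powR (c / r) s^-1).
  by apply: mulr_gt0; [rewrite ln_gt0// ltr1n|rewrite powR_gt0// divr_gt0].
move=> v v0 vr; pose x := powR (c / v) s^-1.
have cv0 : 0 < c / v by rewrite divr_gt0.
have xs : powR x s = c / v by rewrite -powRrM mulVf ?gt_eqF// powRr1// ltW.
have x0 : 0 <= x by exact: powR_ge0.
have xN2 : N2 <= x.
  have E : powR (powR N2 s) s^-1 = N2 by rewrite -powRrM mulfV ?gt_eqF// powRr1// ltW.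
  rewrite -E /x; apply: ge0_ler_powR; rewrite ?nnegrE ?powR_ge0 ?invr_ge0 ?(ltW s0) ?(ltW cv0)//.
  rewrite ler_pdivlMr// mulrC -ler_pdivlMr ?powR_gt0//.
  by apply/ltW/(lt_trans vr).
exists (Num.truncn x).
have Nx : (Num.truncn x)%:R <= x by rewrite truncn_le.
have xN := truncnS_gt x.
have NN : (maxn N1 1 <= Num.truncn x)%N.
  by have := le_lt_trans xN2 xN; rewrite /N2 ltr_nat ltnS => /ltnW.
split.
- by apply: leq_trans NN; exact: leq_maxl.
- by apply: leq_trans NN; exact: leq_maxr.
- by rewrite -xs; apply: ge0_ler_powR; rewrite ?nnegrE ?(ltW s0).
have -> : ln 2 * powR (c / r) s^-1 * powR (r / v) s^-1 = ln 2 * x.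
  rewrite -mulrA -powRM ?divr_ge0 ?(ltW c0) ?(ltW r0) ?(ltW v0)//.
  by rewrite mulrA divfK// gt_eqF.
rewrite -[leRHS]lnK ?posrE ?exprn_gt0// ler_expR lnXn// -(mulr_natr (ln 2)).
by apply: ler_wpM2l; [rewrite ln_ge0// ler1n|exact: ltW].
Qed.

Theorem mainTheorem1 (R : realType) (n : nat) (hn : (2 <= n)%N) (w : 'I_n -> R)
    (F f : vec R n -> vec R n) (s : R) :
  analytic_on F (@inD1 R n) ->
  (forall z, inD1 z -> F z = (fun j => (0 +i* w j)%C * z j + f z j)) ->
  f (@vzero R n) = @vzero R n ->
  Dzero f ->
  nonresonant w ->
  0 < s ->
  (Bruno w s \/ (n = 2%N /\ Bruno1_at w s)) ->
  exists r0 : R, 0 < r0 /\ forall r : R, 0 < r -> r < r0 -> r < 1 ->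
    exists A B C : R, 0 < A /\ 0 < B /\ 0 < C /\
      forall z0 : vec R n, 0 < vnorm z0 -> vnorm z0 < r / 2 ->
        let T := A^-1 * expR (B * powR (r / vnorm z0) s^-1) in
        (exists z : R -> vec R n, z 0 = z0 /\ is_sol F [set t | `|t| <= T] z /\
           forall t, `|t| <= T -> vnorm (z t) <= C * r) /\
        (forall z : R -> vec R n, z 0 = z0 -> is_sol F [set t | `|t| <= T] z ->
           forall t, `|t| <= T -> vnorm (z t) <= C * r).
Proof.
move=> hF hFf f0 Df nr s0 hB.
have hdiv : divisor_bound w s.
  case: hB => [hB|[n2 hB]]; last exact: Bruno1_divisor_bound.
  by apply: Bruno_divisor_bound => //; exact: ltnW.
have [rho [M [g [rho01 M1 gsize gnorm gtail]]]] := analytic_words hF hFf f0 Df.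
have [rn [Cn [N1 [/andP[rn0 rn8] Cn1 hnf]]]] := normal_form nr rho01 M1 hFf gsize gnorm gtail s0 hdiv.
have [L L0 Flip] := field_lipschitz rho01 M1 hFf gnorm gtail.
have F0 : F (@vzero R n) = @vzero R n.
  rewrite hFf; last by move=> j; rewrite /vzero cabs0.
  by apply/funext => j; rewrite f0 /vzero mulr0 addr0.
have {rho01} /andP[rho0 rho2] := rho01.
have Cn0 : 0 < Cn by exact: lt_le_trans Cn1.
(* With this constant c, the condition N^s <= c / |z0| says |z0| <= R1/16. *)
have c0 : 0 < rn / (16 * Cn) by rewrite divr_gt0// mulr_gt0.
have [r0 r00 hr0] := optimal_order N1 c0 s0.
exists r0; split=> // r rgt0 rr0 r1; have [B B0 hN] := hr0 r rgt0 rr0.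
(* 256 = 2 * 128: the stability time is 2^N / 128, while the exponential is bounded by 2^(N+1). With
   C = 1/r the bound C r is 1: [is_sol] keeps any solution in the unit polydisc, and the constructed
   one is bounded by [R1 <= 1]. *)
exists 256, B, r^-1; split; first by []; split=> //.
split; first by rewrite invr_gt0.
move=> z0 z00 z0r T; rewrite mulVf ?gt_eqF//; split; last first.
  move=> z _ hz t ht; apply: vnorm_le => // j.
  by have [h _] := hz t ht; exact: ltW.
have z0r' : vnorm z0 < r by apply: (lt_trans z0r); clear -rgt0; lra.
have [N [NN1 N0 Ns hexp]] := hN _ z00 z0r'.
have [/andP[R10 R1r] [h [h0 hlip hcurve]]] := hnf N NN1 N0.
set R1 := rn / _ in R10 R1r hlip hcurve.
have R1rho : R1 <= rho / 8 by exact: le_trans rn8.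
have hz0 : vnorm z0 <= R1 / 16.
  have Ns0 : 0 < powR (N%:R : R) s by rewrite powR_gt0// ltr0n.
  have gen (a b p : R) : a / (b * p) / 16 = a / (16 * b) / p by rewrite !invfM; ring.
  by rewrite /R1 gen ler_pdivlMr// mulrC -ler_pdivlMr.
have b0 : 0 < rho / 4 by clear -rho0; lra.
have R1b : 0 < R1 <= rho / 4 by rewrite R10 /=; clear -R1rho rho0; lra.
have R11 : R1 <= 1 by clear -R1rho rho2; lra.
have b2 : 2 * (rho / 4) = rho / 2 by clear; field.
have [|z [zz0 hz]] := @stability_at_order R n F h w L (rho / 4) R1 N z0 L0 b0 R1b R11 F0 _ h0 hlip hcurve hz0.
  by rewrite b2.
have TE : T <= 2 ^+ N / 128.
  by rewrite exprS in hexp; rewrite /T; clear -hexp; lra.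
have R1lt : R1 < 1 by clear -R1rho rho2; lra.
exists z; split=> //; split.
  move=> t ht; have [h1 h2] := hz t (le_trans ht TE); split=> // j.
  exact: le_lt_trans (cabs_le_vnorm _ _) (le_lt_trans h1 R1lt).
by move=> t ht; have [h1 _] := hz t (le_trans ht TE); exact: le_trans h1 R11.
Qed.
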